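(* Let $p$ be prime and $1\le n\le k$ integers. Let $(k_1,\dots,k_s)$ be a partition of $k$ and for each $i$ let $1,\omega_i,\dots,\omega_i^{k_i-1}$ be a basis of $\mathbb{F}_{p^{k_i}}$ over $\mathbb{F}_p$. Let $L_{i,j}$ ($1\le i\le s$, $1\le j\le k_i$) be $k$ linear forms in $\mathbb{F}_p[X_1,\dots,X_n]$ such that the $k\times n$ coefficient matrix has rank $n$, and put $\lambda_i(\mathbf{x})=\sum_{j=1}^{k_i}L_{i,j}(\mathbf{x})\omega_i^{j-1}\in\mathbb{F}_{p^{k_i}}$ for $\mathbf{x}\in\mathbb{Z}^n$. Let $1\le H\le p^{1/2}$ be an integer, $\mathbf{N}\in\mathbb{Z}^n$, and $\mathbf{H}=(H_1,\dots,H_n)$ integers with $H\le H_i\le2H$. Then for every $\varepsilon>0$, $$E_{n,k}((\mathbf{N},\mathbf{N}+\mathbf{H}])\ll_{k,\varepsilon}H^{2k}p^{\varepsilon},$$ where $E_{n,k}((\mathbf{N},\mathbf{N}+\mathbf{H}])=\#\{(\mathbf{x},\mathbf{x}',\mathbf{y},\mathbf{y}')\in(\mathbf{N},\mathbf{N}+\mathbf{H}]^4:\lambda_i(\mathbf{x})\lambda_i(\mathbf{y}')=\lambda_i(\mathbf{x}')\lambda_i(\mathbf{y})\text{ in }\mathbb{F}_{p^{k_i}}\text{ for all }i\}$.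
   Context: $(a,b]$ denotes integers $a<x\le b$; $(\mathbf{N},\mathbf{N}+\mathbf{H}]=\prod_i(N_i,N_i+H_i]$. Linear forms are evaluated at integer vectors by reduction mod $p$. *)

(* Defs.v *)
From HB Require Import structures.
From mathcomp Require Import all_boot all_order all_algebra.
From mathcomp Require Import all_classical all_reals all_analysis.
Set Implicit Arguments. Unset Strict Implicit. Unset Printing Implicit Defensive.
Import Order.TTheory GRing.Theory Num.Theory.
Local Open Scope ring_scope.

Definition lform (p m n : nat) (A : 'M['F_p]_(m, n)) (j : 'I_m)
  (x : 'I_n -> int) : 'F_p :=
  \sum_(l < n) A j l * (x l)%:~R.

(* Embedding of F_p into a field F of characteristic p (c |-> c mod p). *)
Definition Fp_to (p : nat) (F : finFieldType) (c : 'F_p) : F := (val c)%:R.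

(* lambda_i(x) = sum_j L_{i,j}(x) omega^(j-1) (indices j from 0 here). *)
Definition lam (p m n : nat) (F : finFieldType) (w : F)
  (A : 'M['F_p]_(m, n)) (x : 'I_n -> int) : F :=
  \sum_(j < m) Fp_to F (lform A j x) * w ^+ j.

(* 1, w, ..., w^(m-1) is a basis of F over F_p: the coordinate map
   F_p^m -> F, c |-> sum_j c_j w^j, is bijective. *)
Definition powbasis (p m : nat) (F : finFieldType) (w : F) : Prop :=
  bijective (fun c : 'rV['F_p]_m => \sum_(j < m) Fp_to F (c 0 j) * w ^+ j).

(* Boxes (N, N+H] in Z^n, parametrized by offsets t with 0 <= t_l < H_l. *)
Definition bmax (n : nat) (Hs : 'I_n -> nat) : nat := (\max_(l < n) Hs l)%N.

Definition boxpt (n : nat) (Hs : 'I_n -> nat) (N : 'I_n -> int)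
  (t : {ffun 'I_n -> 'I_(bmax Hs)}) : 'I_n -> int :=
  fun l => N l + (val (t l))%:Z + 1.

Definition inbox (n : nat) (Hs : 'I_n -> nat)
  (t : {ffun 'I_n -> 'I_(bmax Hs)}) : bool :=
  [forall l, (val (t l) < Hs l)%N].

Definition Enk (p s n : nat) (kk : 'I_s -> nat) (F : 'I_s -> finFieldType)
  (w : forall i, F i) (L : forall i, 'M['F_p]_(kk i, n))
  (N : 'I_n -> int) (Hs : 'I_n -> nat) : nat :=
  #|[set q : {ffun 'I_n -> 'I_(bmax Hs)} * {ffun 'I_n -> 'I_(bmax Hs)}
             * {ffun 'I_n -> 'I_(bmax Hs)} * {ffun 'I_n -> 'I_(bmax Hs)} |
     let: (tx, tx', ty, ty') := q in
     [&& inbox tx, inbox tx', inbox ty, inbox ty' &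
      [forall i : 'I_s,
        lam (w i) (L i) (boxpt N tx) * lam (w i) (L i) (boxpt N ty')
        == lam (w i) (L i) (boxpt N tx') * lam (w i) (L i) (boxpt N ty)]]]|.

(* Main.v *)
Require Import Defs.
From mathcomp Require Import all_boot all_order all_algebra.
From mathcomp Require Import finfield reals exp trigo.
From mathcomp Require Import zify ring lra.
Set Implicit Arguments. Unset Strict Implicit. Unset Printing Implicit Defensive.
Import Order.TTheory GRing.Theory Num.Theory.

(* The energy bound is proved by induction on the total degree k.  Pairs (x, x')
   live in V = F_p^(2k) and are grouped by their class in the product of the projective lines over the fields F_i; the
   vectors of the class of w form the subgroup [Gam K w] of order p^k, and the energy is
   controlled by the number N_q(w) of points of [Gam K w] in small boxes of radius q.

   If the integer lifts of these points have rank at most k, N_q(w) grows at most like q^k.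
   Starting from the first dyadic scale at which no coordinate of the class vanishes
   identically, the sum of N_q(w)^2 reduces to a count of pairs in which one vector vanishes
   on a nonempty set of blocks; that count is bounded by Cauchy-Schwarz and the induction
   hypothesis.  If the rank exceeds k, orthogonality makes the rank of the dual lattice less
   than k, and a Fourier argument bounds N_q(w) by the number of dual points in a box of
   radius about p^(1/2), where the first case applies to the dual system of forms. *)

(** The obstacle is that a vector vanishing in some block is parallel there to everything:
    parallelism stops being transitive, and the small points of a class may all be of this kind and
    not determine the class. Hence the nonvanishing condition in [energy] and the induction on
    blocks. The critical scale exploits an imbalance. At radius [2q] every block is nonzero at some
    point of the class, so a fixed proportion of the points survives, in a slightly larger box, as
    nonvanishing points; each determines its class, which has only [p^k] members. At radius [q] all
    points still vanish on a common block and are counted by energies with fewer blocks. The scale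
    [p^(1/2)] enters because there a crude estimate [p^(2k)] for the second moment of N_q(w) already
    has the right size; duality carries it to smaller radii when the rank is large. Each induction
    step sums over dyadic scales and costs one factor [lg p], whence [p^eps]. The bound is stated
    for all fields, forms and translates at once because restriction and duality change them. *)

Lemma sum_CauchySchwarz (T : finType) (P : pred T) (a b : T -> nat) :
  (\sum_(i | P i) a i * b i) ^ 2 <=
  (\sum_(i | P i) a i ^ 2) * (\sum_(i | P i) b i ^ 2).
Proof.
rewrite -mulnn big_distrlr /= -(leq_pmul2l (isT : 0 < 2)).
have -> (A B : nat) : 2 * (A * B) = A * B + B * A by lia.
rewrite !big_distrlr /= -big_split /= big_distrr /=; apply: leq_sum => i _.
rewrite -big_split big_distrr /=; apply: leq_sum => j _.
have := (nat_Cauchy (a i * b j) (b i * a j)).1; rewrite !expnMn.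
by have -> : 2 * (a i * b i * (a j * b j)) = 2 * (a i * b j * (b i * a j)) by lia.
Qed.

Lemma card_fiber_le (T U : finType) (f : T -> U) (A : {set T}) (N : nat) :
  (forall u, #|[set x in A | f x == u]| <= N) -> #|A| <= #|U| * N.
Proof.
move=> h; rewrite -sum1_card (partition_big f predT) //=.
rewrite -sum_nat_const; apply: leq_sum => u _.
by apply: leq_trans (h u); rewrite -sum1_card; apply/eq_leq/eq_bigl => x; rewrite inE.
Qed.

(** Subtracting one fixed element of [A] injects [A] into [B]. This is how points of a translated
    box are compared with points of a subgroup in a centred box. *)
Lemma card_le_diff (V : finZmodType) (A B : {set V}) :
  {in A &, forall u v, (u - v)%R \in B} -> #|A| <= #|B|.
Proof.
move=> h; case: (set_0Vmem A) => [->|[v vA]]; first by rewrite cards0.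
rewrite -(card_imset _ (@addIr V (- v)%R)); apply: subset_leq_card.
by apply/subsetP => _ /imsetP[u uA ->]; apply: h.
Qed.

(** * Counting pairs related by an equivalence *)

Section RelPairs.
Variables (T T' : finType) (R : rel T) (c : T -> T').

Definition relpairs (X Y : {set T}) : nat :=
  \sum_(x in X) \sum_(y in Y) R x y.

Variable D : {set T}.
Hypothesis Rc : {in D &, forall x y, R x y = (c x == c y)}.

Lemma relpairsE (X Y : {set T}) : X \subset D -> Y \subset D ->
  relpairs X Y =
  \sum_(t : T') #|[set x in X | c x == t]| * #|[set y in Y | c y == t]|.
Proof.
move=> /subsetP XD /subsetP YD; rewrite /relpairs (partition_big c predT) //=.
apply: eq_bigr => t _; rewrite -sum1_card big_distrl /=.
rewrite [RHS](eq_bigl (fun x => (x \in X) && (c x == t))); last by move=> x; rewrite inE.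
apply: eq_bigr => x /andP[xX /eqP xt]; rewrite mul1n -sum1_card big_mkcond /=.
rewrite [RHS]big_mkcond /=; apply: eq_bigr => y _; rewrite inE.
case: ifP => //= yY; rewrite Rc ?(XD _ xX) ?(YD _ yY) // xt eq_sym.
by case: (c y == t).
Qed.

Lemma relpairs_CS (X Y : {set T}) : X \subset D -> Y \subset D ->
  relpairs X Y ^ 2 <= relpairs X X * relpairs Y Y.
Proof.
move=> XD YD; rewrite !relpairsE //.
apply: leq_trans (sum_CauchySchwarz _ _ _) _.
by rewrite leq_mul //; apply: leq_sum => t _; rewrite mulnn.
Qed.

(** Cauchy-Schwarz bounds each off-diagonal pair of pieces by the diagonal bound [M], and there are
    [#|U| ^ 2] pairs of pieces. *)
Lemma relpairs_cover (U : finType) (t : T -> U) (X : {set T}) (M : nat) :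
  X \subset D ->
  (forall u, relpairs [set x in X | t x == u] [set x in X | t x == u] <= M) ->
  relpairs X X <= #|U| ^ 2 * M.
Proof.
move=> XD h.
have -> : relpairs X X = \sum_(u : U) \sum_(v : U)
   relpairs [set x in X | t x == u] [set x in X | t x == v].
  rewrite /relpairs (partition_big t predT) //=; apply: eq_bigr => u _.
  rewrite [RHS]exchange_big /=.
  rewrite [RHS](eq_bigl (fun x => (x \in X) && (t x == u))); last by move=> x; rewrite inE.
  apply: eq_bigr => x _; rewrite (partition_big t predT) //=.
  by apply: eq_bigr => v _; apply: eq_bigl => y; rewrite inE.
have sD u : [set x in X | t x == u] \subset D.
  by apply: subset_trans XD; apply/subsetP => x; rewrite inE => /andP[].
apply: (@leq_trans (\sum_(u : U) \sum_(v : U) M)).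
  apply: leq_sum => u _; apply: leq_sum => v _.
  rewrite -leq_sqr; apply: leq_trans (relpairs_CS _ _) _ => //.
  by rewrite -mulnn leq_mul.
by rewrite !sum_nat_const mulnA mulnn.
Qed.

Lemma relpairs_sub (X Y X' Y' : {set T}) : X \subset X' -> Y \subset Y' ->
  relpairs X Y <= relpairs X' Y'.
Proof.
move=> /subsetP XX /subsetP YY; rewrite /relpairs big_mkcond [X in _ <= X]big_mkcond /=.
apply: leq_sum => x _; case: ifP => // xX; rewrite XX //.
rewrite big_mkcond [X in _ <= X]big_mkcond /=.
by apply: leq_sum => y _; case: ifP => // yY; rewrite YY.
Qed.
End RelPairs.

Lemma trunc_log_bounds (n : nat) : 0 < n ->
  2 ^ trunc_log 2 n <= n < 2 * 2 ^ trunc_log 2 n.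
Proof. by move=> n0; rewrite trunc_logP //= -expnS trunc_log_ltn. Qed.

Lemma leq_pow (m n e : nat) : m <= n -> m ^ e <= n ^ e.
Proof. by case: e => // e mn; rewrite leq_exp2r. Qed.

(** * Centred lifts, boxes and the rational rank of lifted points *)

Definition lft (p : nat) (a : 'F_p) : int :=
  if 2 * (a : nat) <= p then Posz (a : nat) else (Posz (a : nat) - Posz p)%R.

Definition nrm (p : nat) (a : 'F_p) : nat := `|lft a|%N.

Section Box.
Variable p : nat.
Hypothesis p_pr : prime p.

Lemma intr_Fp_eq0 (z : int) : (z%:~R == 0 :> 'F_p)%R = (p %| `|z|)%N.
Proof.
case: z => n /=; first by rewrite -pmulrn -(dvdn_pcharf (pchar_Fp p_pr)).
by rewrite NegzE mulrNz oppr_eq0 -pmulrn -(dvdn_pcharf (pchar_Fp p_pr)).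
Qed.

Lemma ltn_Fp (a : 'F_p) : (a : nat) < p.
Proof. by rewrite -{2}(Fp_cast p_pr) ltn_ord. Qed.

Lemma lftK (a : 'F_p) : ((lft a)%:~R = a)%R.
Proof.
rewrite /lft; case: ifP => _; first by rewrite -pmulrn natr_Zp.
by rewrite mulrzBr -!pmulrn natr_Zp (pcharf0 (pchar_Fp p_pr)) subr0.
Qed.

(** The centred lift is the smallest in its residue class: any other lift differs from it by at
    least [p], while [nrm a] is at most [p/2]. *)
Lemma nrm_le (z : int) (a : 'F_p) : (z%:~R = a)%R -> nrm a <= `|z|.
Proof.
move=> za; have : p %| `|(z - lft a)%R|.
  by rewrite -intr_Fp_eq0 mulrzBr za lftK subrr.
have := ltn_Fp a; rewrite /nrm /lft.
set b := (a : nat) => bp; case: ifP => hb /dvdnP[[|[|c]] hc]; nia.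
Qed.

Lemma nrmD (a b : 'F_p) : nrm (a + b)%R <= nrm a + nrm b.
Proof.
apply: leq_trans (nrm_le (z := (lft a + lft b)%R) _) _.
  by rewrite mulrzDr !lftK.
by rewrite /nrm; lia.
Qed.

Lemma nrmB (a b : 'F_p) : nrm (a - b)%R <= nrm a + nrm b.
Proof.
apply: leq_trans (nrm_le (z := (lft a - lft b)%R) _) _.
  by rewrite mulrzBr !lftK.
by rewrite /nrm; lia.
Qed.

Lemma nrm0 : nrm (0 : 'F_p)%R = 0.
Proof. by apply/eqP; rewrite -leqn0 (nrm_le (z := 0)). Qed.

Lemma nrm_eq0 (a : 'F_p) : nrm a = 0 -> a = 0%R.
Proof. by move=> /eqP; rewrite absz_eq0 => /eqP h; rewrite -(lftK a) h. Qed.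

Lemma nrmMn (a : 'F_p) (t : nat) : nrm (a *+ t)%R <= t * nrm a.
Proof.
elim: t => [|t IH]; first by rewrite mulr0n nrm0.
by rewrite mulrS mulSn (leq_trans (nrmD _ _)) // leq_add2l.
Qed.

Lemma nrm_nat (n : nat) : nrm (n%:R : 'F_p)%R <= n.
Proof. exact: (nrm_le (z := n)). Qed.

Lemma nrm_lt (a : 'F_p) : nrm a < p.
Proof.
have := ltn_Fp a; have := prime_gt0 p_pr; rewrite /nrm /lft.
by set b := (a : nat); case: ifP; lia.
Qed.

(** Index of the interval of length [q] containing the lift. The shift by [m] makes the argument
    nonnegative when [nrm a < m], so the absolute value is then only a cast. *)
Definition cell (m q : nat) (a : 'F_p) : nat := `|(lft a + Posz m)%R|%N %/ q.

Lemma cell_lt (m q c : nat) (a : 'F_p) : 0 < q -> nrm a < m -> 2 * m <= c * q ->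
  cell m q a < c.
Proof. by move=> q0 am hm; rewrite /cell ltn_divLR //; rewrite /nrm in am; lia. Qed.

(** The conclusion concerns the integer lifts and not just their residues; the rational
    interpolation in [rank_cover] depends on this. *)
Lemma cell_close (m q : nat) (a b : 'F_p) : 0 < q -> nrm a < m -> nrm b < m ->
  cell m q a = cell m q b -> `|(lft a - lft b)%R|%N < q.
Proof.
rewrite /cell /nrm => q0 am bm hc.
have := divn_eq `|(lft a + Posz m)%R|%N q; have := divn_eq `|(lft b + Posz m)%R|%N q.
rewrite hc; have := ltn_pmod `|(lft a + Posz m)%R|%N q0.
have := ltn_pmod `|(lft b + Posz m)%R|%N q0.
set x := _ %/ _; set r1 := _ %% _; set r2 := _ %% _; move: (x * q) => y.
lia.
Qed.

Section Dim.
Variable d : nat.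
Local Notation V := 'rV['F_p]_d.

(** The strict inequality makes [box 1] the zero vector alone, which is the bottom of the dyadic
    scales. *)
Definition box (q : nat) : {set V} := [set w : V | [forall j, nrm (w ord0 j) < q]].
Definition tbox (a : V) (m : nat) : {set V} := [set w : V | (w - a)%R \in box m].

Lemma boxP (q : nat) (w : V) : reflect (forall j, nrm (w ord0 j) < q) (w \in box q).
Proof. by rewrite inE; apply: forallP. Qed.

Lemma box_sub (a b : nat) : a <= b -> box a \subset box b.
Proof.
by move=> ab; apply/subsetP => w /boxP h; apply/boxP => j; apply: leq_trans (h j) ab.
Qed.

Lemma box0 (q : nat) : 0 < q -> 0%R \in box q.
Proof. by move=> q0; apply/boxP => j; rewrite mxE nrm0. Qed.

Lemma box1 : box 1 = [set 0%R].
Proof.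
apply/setP => w; rewrite [in RHS]inE; apply/idP/eqP => [/boxP h|->]; last exact: box0.
by apply/rowP => j; rewrite mxE; apply: nrm_eq0; have := h j; rewrite ltnS leqn0 => /eqP.
Qed.

Lemma boxB (a b : nat) (u v : V) : u \in box a -> v \in box b ->
  (u - v)%R \in box (a + b).
Proof.
move=> /boxP hu /boxP hv; apply/boxP => j; rewrite !mxE.
have := nrmB (u ord0 j) (v ord0 j); have := hu j; have := hv j.
by move: (nrm _) (nrm _) (nrm _) => x y z; lia.
Qed.

Lemma box_addMn (a b k t : nat) (u v : V) : u \in box a -> v \in box b -> t <= k ->
  (u + v *+ t)%R \in box (a + k * b).
Proof.
move=> /boxP hu /boxP hv tk; apply/boxP => j; rewrite !mxE mulmxnE.
have := nrmD (u ord0 j) (v ord0 j *+ t)%R; have := nrmMn (v ord0 j) t.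
have := hu j; have : t * nrm (v ord0 j) <= k * b by rewrite leq_mul // ltnW.
by move: (nrm _) (nrm _) (nrm _) (t * _) => x y z y'; lia.
Qed.

Lemma box_full (q : nat) : p <= q -> box q = setT.
Proof.
move=> pq; apply/setP => w; rewrite [in RHS]inE; apply/boxP => j.
exact: leq_trans (nrm_lt _) pq.
Qed.

(** The translated box splits into [(2 * c) ^ d] cells of side [q]. Two points of one cell differ by
    an element of [box q], so [card_le_diff] applies to each cell, and the centre [a] disappears
    from the bound. *)
Lemma cover_card (A B : {set V}) (a : V) (m q c : nat) :
  0 < q -> m <= c * q -> A \subset tbox a m ->
  {in A &, forall u v, (u - v)%R \in box q -> (u - v)%R \in B} ->
  #|A| <= (2 * c) ^ d * #|B|.
Proof.
move=> q0 mc /subsetP Am hB.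
(* For [c = 0] there are no cells to index by; the radius is 0, so [A] is empty unless [d = 0]. *)
case: c mc => [|c] mc.
  have m0 : m = 0 by lia.
  case: (posnP d) => [d0|d0]; last first.
    case: (set_0Vmem A) => [->|[v vA]]; first by rewrite cards0.
    by have := Am v vA; rewrite inE => /boxP /(_ (Ordinal d0)); rewrite m0.
  have -> : (2 * 0) ^ d = 1 by rewrite d0.
  rewrite mul1n; apply: card_le_diff => u v uA vA; apply: hB => //.
  by apply/boxP => j; have := ltn_ord j; rewrite [X in _ < X]d0.
pose f (w : V) : {ffun 'I_d -> 'I_(2 * c.+1)} :=
  [ffun j => inord (cell m q ((w - a)%R ord0 j))].
have lt_c w j : w \in A -> cell m q ((w - a)%R ord0 j) < 2 * c.+1.
  move=> wA; apply: cell_lt => //; last by lia.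
  by have := Am w wA; rewrite inE => /boxP.
apply: leq_trans (card_fiber_le (f := f) (N := #|B|) _) _; last first.
  by rewrite card_ffun !card_ord.
move=> t; apply: card_le_diff => u v; rewrite !inE => /andP[uA /eqP ut] /andP[vA /eqP vt].
apply: hB => //; apply/boxP => j.
have : f u j = f v j by rewrite ut vt.
rewrite !ffunE => /(congr1 (@nat_of_ord _)); rewrite !inordK ?lt_c // => hc.
have hu := Am u uA; have hv := Am v vA; rewrite !inE in hu hv.
move/forallP: hu => /(_ j) hu; move/forallP: hv => /(_ j) hv.
apply: leq_ltn_trans (cell_close q0 hu hv hc); apply: nrm_le.
by rewrite mulrzBr !lftK !mxE; ring.
Qed.

Lemma tbox0 (q : nat) : tbox 0 q = box q.
Proof. by apply/setP => w; rewrite !inE subr0. Qed.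

Lemma card_tbox_le (a : V) (m : nat) : #|tbox a m| <= (2 * m) ^ d.
Proof.
have := @cover_card (tbox a m) [set 0%R] a m 1 m isT.
rewrite cards1 !muln1; apply => // u v _ _.
by rewrite box1.
Qed.

Lemma card_box_ge (q : nat) : q <= p -> q ^ d <= #|box q|.
Proof.
move=> qp; pose g (t : {ffun 'I_d -> 'I_q}) : V := (\row_j (t j : nat)%:R)%R.
have gI : injective g.
  move=> s t /rowP h; apply/ffunP => j; apply: val_inj; have := h j; rewrite !mxE.
  move/(congr1 (fun x : 'F_p => x : nat)); rewrite !val_Fp_nat //.
  by rewrite !modn_small // (leq_trans (ltn_ord _)).
have := card_imset predT gI; rewrite card_ffun !card_ord => <-.
apply: subset_leq_card; apply/subsetP => _ /imsetP[t _ ->].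
by apply/boxP => j; rewrite mxE (leq_ltn_trans (nrm_nat _)).
Qed.

Definition lft_row (w : V) : 'rV[rat]_d := (\row_j (lft (w ord0 j))%:~R)%R.
Definition lft_span (A : {set V}) : 'M[rat]_d := (\sum_(w in A) <<lft_row w>>)%MS.
(** The rank is over the rationals: for a subgroup cut by a box of radius at most [p/2] it counts
    the successive minima, below that radius, of the lattice of integer vectors reducing into the
    subgroup. *)
Definition lft_rank (A : {set V}) : nat := \rank (lft_span A).

Lemma lft_span_sub (A : {set V}) (w : V) : w \in A -> (lft_row w <= lft_span A)%MS.
Proof. by move=> wA; rewrite (sumsmx_sup w) // genmxE. Qed.

Lemma lft_rankS (A B : {set V}) : A \subset B -> lft_rank A <= lft_rank B.
Proof.
move=> /subsetP AB; apply: mxrankS; apply/sumsmx_subP => w wA.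
by rewrite genmxE lft_span_sub // AB.
Qed.

Lemma lft_rank_orth (A B : {set V}) :
  {in A & B, forall u v, lft_row u *m (lft_row v)^T = 0}%R ->
  lft_rank A + lft_rank B <= d.
Proof.
move=> h; rewrite /lft_rank -[\rank (lft_span B)]mxrank_tr.
apply: mulmx0_rank_max; apply/sub_kermxP; apply/sumsmx_subP => u uA; rewrite genmxE.
apply/sub_kermxP; apply: (can_inj (@trmxK _ _ _)); rewrite trmx_mul trmxK trmx0.
apply/sub_kermxP; apply/sumsmx_subP => v vB; rewrite genmxE; apply/sub_kermxP.
by apply: (can_inj (@trmxK _ _ _)); rewrite trmx_mul trmxK trmx0 h.
Qed.

End Dim.
End Box.

(** * Coordinates on row spaces and subgroups *)

Lemma row_free_colsub_unit (K : fieldType) (r d : nat) (A : 'M[K]_(r, d)) :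
  row_free A -> exists f : {ffun 'I_r -> 'I_d}, colsub f A \in unitmx.
Proof.
move=> fA; have fT : row_full (A^T)%R by rewrite /row_full mxrank_tr.
exists (fullrankfun fT); have := fullrowsub_unit fT.
by rewrite -unitmx_tr trmx_mxsub trmxK.
Qed.

Lemma colsub_unit_coords (K : fieldType) (r d : nat) (A : 'M[K]_(r, d))
  (f : 'I_r -> 'I_d) (fA : colsub f A \in unitmx) :
  let B := (invmx (colsub f A) *m A)%R in
  [/\ colsub f B = 1%:M%R, A = (colsub f A *m B)%R &
      forall w : 'rV[K]_d, (w <= A)%MS -> w = (colsub f w *m B)%R].
Proof.
move=> B; have AB : A = (colsub f A *m B)%R by rewrite mulmxA mulmxV // mul1mx.
split=> //; first by rewrite -mulmx_colsub mulVmx.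
by move=> w /submxP[u ->]; rewrite {1}AB mulmxA mulmx_colsub.
Qed.

(** The chosen minor is the identity with column [i] replaced, so in the expansion along row [i] a
    single term survives, with an identity cofactor. *)
Lemma det_colsub_exchange (K : fieldType) (r d : nat) (B : 'M[K]_(r, d))
  (f g : 'I_r -> 'I_d) (i : 'I_r) (j : 'I_d) :
  colsub f B = 1%:M%R -> (forall l, g l = if l == i then j else f l) ->
  (\det (colsub g B) = B i j)%R.
Proof.
move=> Bf hg; have Bfl l l' : B l (f l') = (l == l')%:R%R.
  by have := congr1 (fun M : 'M_r => M l l') Bf; rewrite !mxE.
rewrite (expand_det_row _ i) (bigD1 i) //= big1 => [|l li]; last first.
  by rewrite mxE hg (negPf li) Bfl eq_sym (negPf li) mul0r.
rewrite addr0 mxE hg eqxx /cofactor addnn -signr_odd odd_double mul1r.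
have -> : row' i (col' i (colsub g B)) = 1%:M%R.
  apply/matrixP => x y; rewrite !mxE hg eq_sym (negPf (neq_lift _ _)) Bfl.
  by rewrite (inj_eq lift_inj).
by rewrite det1 mulr1.
Qed.

(* Choosing the maximal minor makes all coordinates at most 1 by Cramer's rule. *)
Lemma row_free_bounded_coords (K : realFieldType) (r d : nat) (A : 'M[K]_(r, d)) :
  row_free A -> exists (f : 'I_r -> 'I_d) (B : 'M[K]_(r, d)),
    (forall i j, `|B i j| <= 1)%R /\
    (forall w : 'rV[K]_d, (w <= A)%MS -> w = (colsub f w *m B)%R).
Proof.
move=> /row_free_colsub_unit[f0 uf0].
pose F (f : {ffun 'I_r -> 'I_d}) : K := `|\det (colsub f A)|%R.
have [f _ fmax] := Order.TotalTheory.arg_maxP F (isT : predT f0).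
have Ff : (0 < F f)%R.
  by apply: lt_le_trans (fmax f0 isT); rewrite normr_gt0 -unitfE -unitmxE.
have uf : colsub f A \in unitmx by rewrite unitmxE unitfE -normr_gt0.
have [Bf AB Bw] := colsub_unit_coords uf.
exists f, (invmx (colsub f A) *m A)%R; split=> // i j.
pose g := [ffun l => if l == i then j else f l].
have <- := det_colsub_exchange Bf (g := g) (i := i) (j := j); last by move=> l; rewrite ffunE.
have := fmax g isT; rewrite /= /F {1}AB -mulmx_colsub det_mulmx normrM.
by rewrite ger_pMr.
Qed.

(** An additive subgroup is an F_p-subspace, since scalars act as natural multiples. Its parameters
    are chosen among the original coordinates, [colsub f], because such a projection sends boxes to
    boxes. *)
Lemma subgroup_coords (p : nat) (p_pr : prime p) (d : nat) (S : {set 'rV['F_p]_d}) :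
  0%R \in S -> {in S &, forall u v, (u + v)%R \in S} ->
  exists (r : nat) (f : 'I_r -> 'I_d) (B : 'M['F_p]_(r, d)),
    [/\ #|S| = p ^ r, colsub f B = 1%:M%R, forall u, (u *m B)%R \in S
      & forall w, w \in S -> w = (colsub f w *m B)%R].
Proof.
move=> S0 SD.
have SMn (n : nat) w : w \in S -> (w *+ n)%R \in S.
  by move=> wS; elim: n => [|n IH]; rewrite ?mulr0n // mulrS SD.
pose A := (\matrix_(i < #|S|) enum_val i)%R.
have memA w : (w <= A)%MS = (w \in S).
  apply/idP/idP => [/submxP[u ->]|wS].
    rewrite mulmx_sum_row; apply: (big_ind (fun x => x \in S)) => // i _.
    rewrite rowK -[u 0%R i]natr_Zp scaler_nat; apply: SMn; exact: enum_valP.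
  have <- : row (enum_rank_in wS w) A = w by rewrite rowK enum_rankK_in.
  exact: row_sub.
have [f uf] := row_free_colsub_unit (row_base_free A).
have [Bf AB Bw] := colsub_unit_coords uf.
set B := (invmx _ *m _)%R in Bf AB Bw.
have uB u : (u *m B)%R \in S.
  rewrite -memA -(eq_row_base A) /B mulmxA; exact: submxMl.
clearbody B; exists (\rank A), f, B; split=> //; last first.
  by move=> w wS; apply: Bw; rewrite eq_row_base memA.
have Binj : injective (fun u : 'rV['F_p]_(\rank A) => u *m B)%R.
  by move=> u v /(congr1 (colsub f)); rewrite -!mulmx_colsub Bf !mulmx1.
have := card_imset predT Binj; rewrite card_mx mul1n card_Fp // => <-.
congr #|_ : {set _}|; apply/setP => w; apply/idP/imsetP => [wS|[u _ ->]//].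
by exists (colsub f w); rewrite ?inE // -Bw // eq_row_base memA.
Qed.

(** * Growth of the point count when the rational rank is small *)

Section RankCover.
Variables (p : nat) (p_pr : prime p) (d : nat).
Local Notation V := 'rV['F_p]_d.

(** Lifts of rank [r <= k] are combinations of [r] of their own coordinates with coefficients at
    most 1. It is enough to cut these [r] coordinates into intervals of length [q]: points that
    agree there differ by at most [k * (q - 1)] in every coordinate. The number of cells is then a
    power [r] and not [d]. *)
Lemma rank_cover (G : {set V}) (Q q k : nat) :
  {in G &, forall u v, (u - v)%R \in G} -> 0 < k -> 0 < q -> q <= Q ->
  lft_rank (G :&: box p d Q) <= k ->
  #|G :&: box p d Q| * q ^ k <= (3 * Q) ^ k * #|G :&: box p d (k * q)|.
Proof.
move=> GB k0 q0 qQ; set A := G :&: _; rewrite /lft_rank; set M := lft_span A => rk.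
have [f [B [B1 Bw]]] := row_free_bounded_coords (row_base_free M).
set r := \rank M in f B B1 Bw rk *.
have {}Bw w : w \in A -> lft_row w = (colsub f (lft_row w) *m B)%R.
  by move=> wA; apply: Bw; rewrite eq_row_base lft_span_sub.
pose c := (2 * Q) %/ q.
have hc : 2 * Q <= c.+1 * q by rewrite ltnW // -ltn_divLR.
have Abox w j : w \in A -> nrm (w ord0 j) < Q.
  by rewrite inE => /andP[_ /boxP].
have cA w j : w \in A -> cell Q q (w ord0 j) < c.+1.
  by move=> wA; apply: cell_lt => //; apply: Abox.
pose t (w : V) : {ffun 'I_r -> 'I_c.+1} := [ffun j => inord (cell Q q (w ord0 (f j)))].
have fib u v : u \in A -> v \in A -> t u = t v -> (u - v)%R \in box p d (k * q).
  move=> uA vA tt; apply/boxP => j.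
  apply: leq_ltn_trans (nrm_le p_pr (z := (lft (u ord0 j) - lft (v ord0 j))%R) _) _.
    by rewrite mulrzBr !lftK // !mxE.
  have close l : (`|(lft (u ord0 (f l)))%:~R - (lft (v ord0 (f l)))%:~R| <= q.-1%:R :> rat)%R.
    have : t u l = t v l by rewrite tt.
    rewrite !ffunE => /(congr1 (@nat_of_ord _)); rewrite !inordK ?cA // => hcl.
    have := cell_close p_pr q0 (Abox u (f l) uA) (Abox v (f l) vA) hcl.
    rewrite -mulrzBr -intr_norm => h; rewrite -[q.-1%:R%R]/((Posz q.-1)%:~R%R) ler_int; lia.
  have : (`|(lft (u ord0 j))%:~R - (lft (v ord0 j))%:~R| <= (k * q.-1)%:R :> rat)%R.
    have := congr1 (fun x : 'rV[rat]_d => x ord0 j) (Bw u uA).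
    have := congr1 (fun x : 'rV[rat]_d => x ord0 j) (Bw v vA).
    rewrite !mxE => -> ->; rewrite -sumrB.
    apply: le_trans (ler_norm_sum _ _ _) _.
    apply: (@le_trans _ _ (\sum_(l < r) q.-1%:R)%R); last first.
      rewrite sumr_const card_ord -mulrnA ler_nat mulnC; nia.
    apply: ler_sum => l _; rewrite !mxE -mulrBl normrM.
    rewrite -[X in (_ <= X)%R]mulr1; apply: ler_pM => //; exact: close.
  rewrite -mulrzBr -intr_norm -[((_)%:R)%R]/((Posz (k * q.-1))%:~R%R) ler_int; nia.
have cardA : #|A| <= c.+1 ^ r * #|G :&: box p d (k * q)|.
  apply: leq_trans (card_fiber_le (f := t) (N := #|G :&: box p d (k * q)|) _) _; last first.
    by rewrite card_ffun !card_ord.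
  move=> x; apply: card_le_diff => u v.
  rewrite [u \in _]inE [v \in _]inE => /andP[uA /eqP ut] /andP[vA /eqP vt].
  rewrite inE fib ?ut ?vt // andbT.
  by move: uA vA; rewrite inE => /andP[uG _]; rewrite inE => /andP[vG _]; apply: GB.
(* There are [2Q/q] intervals rounded down, plus one; as [q <= Q], the extra one costs at most
   [Q]. *)
have h3 : c.+1 * q <= 3 * Q by have := leq_trunc_div (2 * Q) q; rewrite -/c; nia.
apply: (@leq_trans (c.+1 ^ r * #|G :&: box p d (k * q)| * q ^ k)); first by rewrite leq_mul.
rewrite mulnAC leq_mul // -(subnKC rk) !expnD mulnA -expnMn leq_mul //.
  exact: leq_pow.
by apply: leq_pow; lia.
Qed.

Lemma doubling (G : {set V}) (q c : nat) :
  {in G &, forall u v, (u - v)%R \in G} -> 0 < q ->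
  #|G :&: box p d (c * q)| <= (2 * c) ^ d * #|G :&: box p d q|.
Proof.
move=> GB q0; apply: (cover_card p_pr (a := 0%R) q0 (leqnn _)).
  by rewrite tbox0 subsetIr.
move=> u v; rewrite inE [v \in _]inE => /andP[uG _] /andP[vG _] h.
by rewrite inE h andbT GB.
Qed.

End RankCover.

(** * The additive character of F_p, split into cosine and sine to stay over the reals *)

Section Characters.
Variables (R : realType) (p : nat).
Hypothesis p_pr : prime p.

Let p_gt0 : (0 < p%:R :> R)%R.
Proof. by rewrite ltr0n prime_gt0. Qed.

Definition ang (z : int) : R := (pi *+ 2 * (z%:~R / p%:R))%R.
Definition chc (a : 'F_p) : R := cos (ang (lft a)).
Definition chs (a : 'F_p) : R := sin (ang (lft a)).

Lemma angD (y z : int) : (ang (y + z) = ang y + ang z)%R.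
Proof. by rewrite /ang mulrzDr; ring. Qed.

Lemma angDp (z : int) : (ang (z + Posz p) = ang z + pi *+ 2)%R.
Proof. by rewrite angD {2}/ang -pmulrn mulfV ?mulr1 // gt_eqF. Qed.

Lemma trig_angMp (z : int) (t : int) :
  (cos (ang (z + Posz p * t)) = cos (ang z)) /\
  (sin (ang (z + Posz p * t)) = sin (ang z)).
Proof.
have pos n (y : int) : (cos (ang (y + Posz p * Posz n)) = cos (ang y)) /\
   (sin (ang (y + Posz p * Posz n)) = sin (ang y)).
  elim: n => [|n [IHc IHs]]; first by rewrite mulr0 addr0.
  have -> : (y + Posz p * Posz n.+1 = y + Posz p * Posz n + Posz p)%R by lia.
  by rewrite angDp cosD2pi sinD2pi.
case: t => n; first exact: pos.
have := pos n.+1 (z + Posz p * Negz n)%R.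
have -> : (z + Posz p * Negz n + Posz p * Posz n.+1 = z)%R by rewrite NegzE; ring.
by case=> -> ->.
Qed.

Lemma chE (z : int) (a : 'F_p) : (z%:~R = a)%R ->
  chc a = cos (ang z) /\ chs a = sin (ang z).
Proof.
move=> za; have : (p %| `|(z - lft a)%R|)%N.
  by rewrite -intr_Fp_eq0 // mulrzBr za lftK // subrr.
move=> /dvdnP[n hn]; rewrite /chc /chs.
have [t ->] : exists t : int, (z = lft a + Posz p * t)%R.
  case: (ltrP 0 (z - lft a)%R) => h; [exists (Posz n) | exists (- Posz n)%R]; nia.
by have [-> ->] := trig_angMp (lft a) t.
Qed.

Lemma chcB (a b : 'F_p) : (chc (a - b) = chc a * chc b + chs a * chs b)%R.
Proof.
have e : ((lft a - lft b)%:~R = a - b)%R by rewrite mulrzBr !lftK.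
have [-> _] := chE e.
rewrite angD /chc /chs -cosB; congr cos; congr (_ + _)%R.
by rewrite /ang mulrNz; ring.
Qed.

Lemma chcD (a b : 'F_p) : (chc (a + b) = chc a * chc b - chs a * chs b)%R.
Proof.
have e : ((lft a + lft b)%:~R = a + b)%R by rewrite mulrzDr !lftK.
have [-> _] := chE e.
by rewrite angD cosD.
Qed.

Lemma chsD (a b : 'F_p) : (chs (a + b) = chs a * chc b + chc a * chs b)%R.
Proof.
have e : ((lft a + lft b)%:~R = a + b)%R by rewrite mulrzDr !lftK.
have [_ ->] := chE e.
by rewrite angD sinD.
Qed.

Lemma chc0 : chc 0%R = 1%R.
Proof. by have [-> _] := chE (z := 0) (erefl (0%:~R : 'F_p)%R); rewrite /ang mul0r mulr0 cos0. Qed.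

Lemma norm_ang (z : int) : (`|ang z| = pi *+ 2 * (`|z|%N%:R / p%:R))%R.
Proof.
have := @pi_ge0 R => pi0.
rewrite /ang !normrM normfV normr_nat natr_absz intr_norm.
by rewrite [X in (X * _)%R]ger0_norm // mulr2n addr_ge0.
Qed.

(** Centred lifts are at most [p/2], so the angle lies in the interval from 0 to [pi], where the
    cosine is injective. *)
Lemma chc_neq1 (a : 'F_p) : a != 0%R -> chc a != 1%R.
Proof.
move=> a0; rewrite /chc -cos_norm norm_ang -/(nrm a).
have := @pi_gt0 R => pi0.
have n0 : (0 < nrm a)%N by rewrite lt0n; apply: contra a0 => /eqP /(nrm_eq0 p_pr) ->.
have n2 : (2 * nrm a <= p)%N.
  have := ltn_Fp p_pr a; rewrite /nrm /lft; set b := (a : nat).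
  by case: ifP; lia.
have q0 : (0 < (nrm a)%:R / p%:R :> R)%R by rewrite divr_gt0 // ltr0n.
have q1 : ((nrm a)%:R / p%:R <= 2^-1 :> R)%R.
  by rewrite ler_pdivrMr // -(ler_pM2l (ltr0n R 2)) mulrA divff ?pnatr_eq0 // mul1r -natrM ler_nat.
apply/eqP; rewrite -[RHS]cos0 => h; have : (pi *+ 2 * ((nrm a)%:R / p%:R) = 0 :> R)%R.
  set y := ((nrm a)%:R / p%:R)%R in q0 q1 h *.
  apply: cos_inj h; rewrite in_itv /= ?lexx ?(ltW pi0) //; nra.
by move/eqP; rewrite mulf_eq0 mulrn_eq0 /= !gt_eqF.
Qed.

(** The angle is at most [pi/4], so the cosine of its double is nonnegative, and the duplication
    formula makes the squared cosine at least 1/2. *)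
Lemma chc_ge_half (a : 'F_p) : (8 * nrm a <= p)%N -> (2^-1 <= chc a)%R.
Proof.
move=> n8; rewrite /chc -cos_norm norm_ang -/(nrm a).
have := @pi_gt0 R => pi0.
have q0 : (0 <= (nrm a)%:R / p%:R :> R)%R by rewrite divr_ge0 // ler0n.
have q1 : ((nrm a)%:R / p%:R <= 8^-1 :> R)%R.
  by rewrite ler_pdivrMr // -(ler_pM2l (ltr0n R 8)) mulrA divff ?pnatr_eq0 // mul1r -natrM ler_nat.
set y := ((nrm a)%:R / p%:R)%R in q0 q1 *.
set x := (pi *+ 2 * y)%R.
have x0 : (0 <= x)%R by rewrite mulr_ge0 // mulrn_wge0 // ltW.
have x4 : (x *+ 2 <= pi / 2)%R by rewrite /x; nra.
have c2 : (0 <= cos (x *+ 2))%R by apply: cos_ge0_pihalf; nra.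
have c1 : (0 <= cos x)%R by apply: cos_ge0_pihalf; nra.
move: c2; rewrite cos_mulr2n; nra.
Qed.

End Characters.

(** * Annihilators and the Fourier bound *)

Definition dotv (p d : nat) (u v : 'rV['F_p]_d) : 'F_p := (\sum_j u ord0 j * v ord0 j)%R.

Section Dual.
Variables (R : realType) (p : nat) (p_pr : prime p) (d : nat).
Local Notation V := 'rV['F_p]_d.

Lemma dotvDl (u u' v : V) : dotv (u + u')%R v = (dotv u v + dotv u' v)%R.
Proof. by rewrite /dotv -big_split; apply: eq_bigr => j _; rewrite mxE mulrDl. Qed.

Lemma dotvBr (u v v' : V) : dotv u (v - v')%R = (dotv u v - dotv u v')%R.
Proof. by rewrite /dotv -sumrB; apply: eq_bigr => j _; rewrite !mxE mulrBr. Qed.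

Lemma dotv_lft (u v : V) :
  ((\sum_j lft (u ord0 j) * lft (v ord0 j))%:~R = dotv u v)%R.
Proof.
rewrite mulrz_sumr; apply: eq_bigr => j _; by rewrite intrM !lftK.
Qed.

(** Keeping [a.-1] on one side preserves a strict inequality, which [lft_row_orth] needs at the
    threshold [p]. *)
Lemma absz_dot_le (u v : V) (a b : nat) : u \in box p d a -> v \in box p d b ->
  (`|(\sum_j lft (u ord0 j) * lft (v ord0 j))%R| <= d * a.-1 * b)%N.
Proof.
move=> /boxP hu /boxP hv; rewrite -mulnA -lez_nat abszE.
apply: le_trans (ler_norm_sum _ _ _) _.
have -> : (Posz (d * (a.-1 * b)) = \sum_(j < d) Posz (a.-1 * b))%R.
  by rewrite sumr_const card_ord -mulr_natl natz.
apply: ler_sum => j _; have := hu j; have := hv j; rewrite /nrm normrM => h1 h2.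
rewrite PoszM; apply: ler_pM => //; lia.
Qed.

Definition orthv (G : {set V}) : {set V} := [set x : V | [forall g in G, dotv g x == 0%R]].

Lemma char_orth (G : {set V}) (x : V) : {in G &, forall u v, (u + v)%R \in G} ->
  x \notin orthv G -> (\sum_(g in G) chc R (dotv g x) = 0)%R.
Proof.
move=> GD; rewrite inE negb_forall => /existsP[g0]; rewrite negb_imply => /andP[g0G nz].
have GE : [set (g + g0)%R | g in G] = G.
  apply/eqP; rewrite eqEcard card_imset ?leqnn ?andbT; last exact: addIr.
  by apply/subsetP => _ /imsetP[g gG ->]; apply: GD.
have shift (F : V -> R) : (\sum_(g in G) F g = \sum_(g in G) F (g + g0))%R.
  rewrite -{1}GE big_imset //=; exact: in2W (@addIr _ _).
set Sc := (\sum_(g in G) _)%R.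
pose Ss := (\sum_(g in G) chs R (dotv g x))%R.
set c := chc R (dotv g0 x); set s := chs R (dotv g0 x).
have h1 : (Sc = Sc * c - Ss * s)%R.
  rewrite {1}/Sc shift mulr_suml mulr_suml -sumrB; apply: eq_bigr => g _.
  by rewrite dotvDl chcD.
have h2 : (Ss = Ss * c + Sc * s)%R.
  rewrite {1}/Ss shift mulr_suml mulr_suml -big_split; apply: eq_bigr => g _.
  by rewrite dotvDl chsD.
have c1 : c != 1%R by apply: chc_neq1.
(* Translation by [g0] multiplies the complex sum S by a root of unity z, so (1 - z) S = 0.
   Multiplying by the conjugate of 1 - z eliminates the sine sum. *)
have h3 : (((1 - c) ^+ 2 + s ^+ 2) * Sc = 0)%R.
  have e1 : ((1 - c) * Sc = - (s * Ss))%R.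
    have -> : (- (s * Ss) = (Sc * c - Ss * s) - Sc * c)%R by ring.
    by rewrite -h1; ring.
  have e2 : ((1 - c) * Ss = s * Sc)%R.
    have -> : (s * Sc = (Ss * c + Sc * s) - Ss * c)%R by ring.
    by rewrite -h2; ring.
  have -> : (((1 - c) ^+ 2 + s ^+ 2) * Sc = (1 - c) * ((1 - c) * Sc) + s * (s * Sc))%R by ring.
  by rewrite e1 -e2; ring.
move/eqP: h3; rewrite mulf_eq0 => /orP[|/eqP//].
have : (0 < (1 - c) ^+ 2)%R by rewrite exprn_even_gt0 //= subr_eq0 eq_sym.
have := sqr_ge0 s => ? ?; rewrite gt_eqF //; lra.
Qed.

(** The weight [T g] is the squared modulus of the character sum over [box h]. It is nonnegative
    everywhere and at least half its maximum on [box Q]: there products with differences of two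
    points of [box h] are at most [d * Q * 2h <= p/8], which is where 16 comes from. Summed over
    [G], orthogonality leaves the pairs whose difference lies in [orthv G]. *)
Lemma dual_box_count (G : {set V}) (Q h : nat) :
  {in G &, forall u v, (u + v)%R \in G} -> (0 < h <= p)%N -> (16 * d * Q * h <= p)%N ->
  (#|G :&: box p d Q| * h ^ d <= 2 * #|G| * #|orthv G :&: box p d (2 * h)|)%N.
Proof.
move=> GD /andP[h0 hp] hQ; set B := box p d h; set N := #|orthv G :&: _|.
have B0 : (0 < #|B|)%N by apply: leq_trans (card_box_ge p_pr d hp); rewrite expn_gt0 h0.
suff main : (#|G :&: box p d Q|%:R * (#|B|%:R * #|B|%:R / 2) <= #|G|%:R * (#|B|%:R * N%:R) :> R)%R.
  have : (#|G :&: box p d Q| * #|B| <= 2 * #|G| * N)%N.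
    rewrite -(ler_nat R) !natrM -(ler_pM2l (_ : 0 < #|B|%:R)%R) ?ltr0n //.
    move: main; set x := (_%:R)%R; set b := (#|B|%:R)%R; set g := (#|G|%:R)%R; set n := (N%:R)%R; lra.
  by apply: leq_trans; rewrite leq_mul // card_box_ge.
pose T g := (\sum_(x in B) \sum_(y in B) chc R (dotv g (x - y)))%R.
have T0 g : (0 <= T g)%R.
  have -> : T g = ((\sum_(x in B) chc R (dotv g x)) ^+ 2 + (\sum_(x in B) chs R (dotv g x)) ^+ 2)%R.
    rewrite !expr2 !big_distrlr -big_split; apply: eq_bigr => x _.
    by rewrite -big_split; apply: eq_bigr => y _; rewrite dotvBr chcB.
  by rewrite addr_ge0 // sqr_ge0.
have Tbig g : g \in box p d Q -> (#|B|%:R * #|B|%:R / 2 <= T g)%R.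
  move=> gQ; have -> : (#|B|%:R * #|B|%:R / 2 = \sum_(x in B) \sum_(y in B) 2^-1 :> R)%R.
    by rewrite !sumr_const -mulrnA -[X in (X = _)%R]mulrC -natrM mulr_natr.
  apply: ler_sum => x xB; apply: ler_sum => y yB; apply: chc_ge_half => //.
  have := absz_dot_le gQ (boxB p_pr xB yB) => hz.
  have := nrm_le p_pr (dotv_lft g (x - y)%R) => hn.
  have := leq_trans hn hz; move: (nrm _) => t ht; nia.
apply: (@le_trans _ _ (\sum_(g in G) T g)%R).
  rewrite (big_setID (box p d Q)) /= -[leLHS]addr0 lerD //; last exact: sumr_ge0.
  rewrite mulr_natl -sumr_const; apply: ler_sum => g; rewrite inE => /andP[_]; exact: Tbig.
have -> : (\sum_(g in G) T g =
   \sum_(x in B) \sum_(y in B) \sum_(g in G) chc R (dotv g (x - y)))%R.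
  by rewrite exchange_big; apply: eq_bigr => x _; rewrite exchange_big.
rewrite mulrCA mulr_natl -sumr_const; apply: ler_sum => x xB.
apply: (@le_trans _ _ (\sum_(y in B) #|G|%:R * ((x - y)%R \in orthv G)%:R)%R).
  apply: ler_sum => y yB; case: (boolP (_ \in orthv G)) => [o|o]; last first.
    by rewrite char_orth // mulr0.
  rewrite mulr1 -sumr_const; apply: ler_sum => g gG.
  by move: o; rewrite inE => /forallP/(_ g); rewrite gG => /eqP->; rewrite chc0.
rewrite -mulr_sumr ler_wpM2l ?ler0n // -natr_sum ler_nat.
rewrite -big_mkcondr sum1_card /=.
have inj : injective (fun y : V => x - y)%R by move=> y y' /addrI/oppr_inj.
rewrite -(card_imset _ inj); apply: subset_leq_card; apply/subsetP => _ /imsetP[y + ->].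
rewrite unfold_in => /andP[yB o]; apply/setIP; split=> //.
by have := boxB p_pr xB yB; rewrite addnn mul2n.
Qed.

End Dual.

(** * The determinant form on a plane over a finite field *)

Definition symp (F : fieldType) (x y : F * F) : F := (x.1 * y.2 - x.2 * y.1)%R.

Section Symp.
Variable F : finFieldType.
Implicit Types x y z : (F * F)%type.

Lemma sympBl x y z : symp (x - y)%R z = (symp x z - symp y z)%R.
Proof. by rewrite /symp /=; ring. Qed.

Lemma sympBr x y z : symp z (x - y)%R = (symp z x - symp z y)%R.
Proof. by rewrite /symp /=; ring. Qed.

Lemma sympN x y : symp y x = (- symp x y)%R.
Proof. by rewrite /symp; ring. Qed.

Lemma symp_eq0C x y : (symp x y == 0%R) = (symp y x == 0%R).
Proof. by rewrite sympN oppr_eq0. Qed.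

Lemma sympxx x : symp x x = 0%R.
Proof. by rewrite /symp; ring. Qed.

Lemma symp0l x : symp 0%R x = 0%R.
Proof. by rewrite /symp /=; ring. Qed.

Lemma symp_scale_l (c : F) x y : symp (c * x.1, c * x.2)%R y = (c * symp x y)%R.
Proof. by rewrite /symp /=; ring. Qed.

Lemma pair_neq0 x : x != 0%R -> (x.1 != 0%R) || (x.2 != 0%R).
Proof.
by case: x => a b /=; apply: contraR; rewrite negb_or !negbK => /andP[/eqP-> /eqP->].
Qed.

(** Proportionality is transitive only through a nonzero middle vector; this is the source of every
    nonvanishing condition below. *)
Lemma symp_trans y x z : y != 0%R -> symp x y = 0%R -> symp y z = 0%R -> symp x z = 0%R.
Proof.
move=> /pair_neq0 y0 /eqP; rewrite subr_eq0 => /eqP h1 /eqP; rewrite subr_eq0 => /eqP h2.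
rewrite /symp; case/orP: y0 => y0; apply: (mulfI y0); rewrite mulr0.
  have -> : (y.1 * (x.1 * z.2 - x.2 * z.1) = x.1 * (y.1 * z.2) - x.2 * y.1 * z.1)%R by ring.
  by rewrite h2 -h1; ring.
have -> : (y.2 * (x.1 * z.2 - x.2 * z.1) = x.1 * y.2 * z.2 - x.2 * (y.2 * z.1))%R by ring.
by rewrite h1 -h2; ring.
Qed.

Lemma symp_nondeg x : x != 0%R -> exists y, symp y x != 0%R.
Proof.
move=> /pair_neq0/orP[h|h]; [exists (0, 1)%R | exists (1, 0)%R].
  by rewrite /symp /= mul0r mul1r sub0r oppr_eq0.
by rewrite /symp /= mul0r mul1r subr0.
Qed.

Lemma card_line x : x != 0%R -> #|[set y : F * F | symp y x == 0%R]| = #|F|.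
Proof.
move=> x0; pose g (c : F) := ((c * x.1)%R, (c * x.2)%R).
have gI : injective g.
  by move=> a b [] h1 h2; case/orP: (pair_neq0 x0) => n; apply: (mulIf n).
rewrite -(card_codom gI); apply: eq_card => y; rewrite inE /symp.
apply/idP/codomP => [|[c ->]]; last by rewrite /=; apply/eqP; ring.
rewrite subr_eq0 => /eqP e; case/orP: (pair_neq0 x0) => n.
  exists (y.1 / x.1)%R; rewrite /g [y]surjective_pairing /= in e *; congr (_, _).
    by rewrite divfK.
  by apply: (mulIf n); rewrite -e mulrAC divfK.
exists (y.2 / x.2)%R; rewrite /g [y]surjective_pairing /= in e *; congr (_, _).
  by apply: (mulIf n); rewrite e mulrAC divfK.
by rewrite divfK.
Qed.

End Symp.

(** * Systems of forms, parallel vectors and their classes *)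

Section Forms.
Variables (p s : nat) (F : 'I_s -> finFieldType) (kk : 'I_s -> nat).
Hypotheses (p_pr : prime p) (cardF : forall i, #|F i| = p ^ kk i).

Definition wt (K : {set 'I_s}) : nat := \sum_(i in K) kk i.

Lemma wtD (K I : {set 'I_s}) : I \subset K -> wt K = wt I + wt (K :\: I).
Proof. by move=> IK; rewrite /wt (big_setID I) (setIidPr IK). Qed.

Section Dim.
Variables (d : nat) (phi : forall i, 'rV['F_p]_d -> F i * F i).
Local Notation V := 'rV['F_p]_d.

Implicit Types (K I : {set 'I_s}) (u v w : V) (X Y : {set V}).

Definition par (K : {set 'I_s}) (v w : V) : bool :=
  [forall i in K, symp (phi i v) (phi i w) == 0%R].
Definition nonvan (K : {set 'I_s}) (w : V) : bool := [forall i in K, phi i w != 0%R].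
Definition vanish (I : {set 'I_s}) : {set V} := [set w | [forall i in I, phi i w == 0%R]].
Definition Gam (K : {set 'I_s}) (w : V) : {set V} := [set v | par K v w].
Definition nvset (K : {set 'I_s}) (X : {set V}) : {set V} := [set w in X | nonvan K w].

(** Given the cardinalities of the fields, these conditions make the family of [phi i] for [i] in
    [K] an additive bijection of [V] onto the product of the planes [F i * F i]. *)
Definition good (K : {set 'I_s}) : Prop :=
  [/\ forall i u v, phi i (u - v)%R = (phi i u - phi i v)%R,
      forall w, (forall i, i \in K -> phi i w = 0%R) -> w = 0%R
    & d = 2 * wt K].

Lemma parP K v w :
  reflect (forall i, i \in K -> symp (phi i v) (phi i w) = 0%R) (par K v w).
Proof. by apply: (iffP 'forall_implyP) => h i iK; apply/eqP/h. Qed.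

Lemma nonvanP K w : reflect (forall i, i \in K -> phi i w != 0%R) (nonvan K w).
Proof. exact: 'forall_implyP. Qed.

Lemma vanishP I w : reflect (forall i, i \in I -> phi i w = 0%R) (w \in vanish I).
Proof. by rewrite inE; apply: (iffP 'forall_implyP) => h i iK; apply/eqP/h. Qed.

Lemma par_refl K w : par K w w.
Proof. by apply/parP => i _; rewrite sympxx. Qed.

Lemma par_sym K v w : par K v w = par K w v.
Proof. by apply: eq_forallb => i; rewrite symp_eq0C. Qed.

Lemma par_trans K v u w : nonvan K v -> par K u v -> par K v w -> par K u w.
Proof.
move=> /nonvanP nv /parP h1 /parP h2; apply/parP => i iK.
by apply: (@symp_trans _ (phi i v)); rewrite ?nv ?h1 ?h2.
Qed.

Lemma par_subset (K K' : {set 'I_s}) v w : K' \subset K -> par K v w -> par K' v w.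
Proof. by move=> /subsetP KK /parP h; apply/parP => i /KK/h. Qed.

Lemma nonvan_subset (K K' : {set 'I_s}) w : K' \subset K -> nonvan K w -> nonvan K' w.
Proof. by move=> /subsetP KK /nonvanP h; apply/nonvanP => i /KK/h. Qed.

(** Among nonvanishing vectors parallelism is an equivalence with [Gam K] as class invariant, so the
    Cauchy-Schwarz inequality for [relpairs] applies. *)
Lemma par_Gam K v w : nonvan K v -> nonvan K w -> par K v w = (Gam K v == Gam K w).
Proof.
move=> nv nw; apply/idP/eqP => [h|e]; last first.
  have : v \in Gam K v by rewrite inE par_refl.
  by rewrite e inE.
apply/setP => u; rewrite !inE; apply/idP/idP => h'; first exact: par_trans nv h' h.
by apply: par_trans nw h' _; rewrite par_sym.
Qed.

Definition energy (K : {set 'I_s}) (X : {set V}) : nat :=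
  relpairs (par K) (nvset K X) (nvset K X).

Lemma par_relE K : {in nvset K setT &, forall v w, par K v w = (Gam K v == Gam K w)}.
Proof. by move=> v w; rewrite !inE /= => nv nw; apply: par_Gam. Qed.

Lemma nvset_subT K X : nvset K X \subset nvset K setT.
Proof. by apply/subsetP => w; rewrite !inE => /andP[]. Qed.

Lemma energy_CS K X Y :
  relpairs (par K) (nvset K X) (nvset K Y) ^ 2 <= energy K X * energy K Y.
Proof. by apply: relpairs_CS (@par_relE K) _ _ _ _; apply: nvset_subT. Qed.

Section Good.
Variable K : {set 'I_s}.
Hypothesis gK : good K.

Lemma phiB i u v : phi i (u - v)%R = (phi i u - phi i v)%R.
Proof. by case: gK. Qed.

Lemma phi0 i : phi i 0%R = 0%R.
Proof. by rewrite -(subrr (0%R : V)) phiB subrr. Qed.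

Lemma phiD i u v : phi i (u + v)%R = (phi i u + phi i v)%R.
Proof. by rewrite -{1}[v]opprK -[(- v)%R]sub0r !phiB phi0 sub0r opprK. Qed.

Lemma phiMn i u n : phi i (u *+ n)%R = (phi i u *+ n)%R.
Proof. by elim: n => [|n IH]; rewrite ?mulr0n ?phi0 // !mulrS phiD IH. Qed.

Lemma phi_inj w : (forall i, i \in K -> phi i w = 0%R) -> w = 0%R.
Proof. by case: gK => _ h _; apply: h. Qed.

Lemma dimE : d = 2 * wt K.
Proof. by case: gK. Qed.

Lemma GamB K' w : {in Gam K' w &, forall u v, (u - v)%R \in Gam K' w}.
Proof.
move=> u v; rewrite !inE => /parP hu /parP hv; apply/parP => i iK.
by rewrite phiB sympBl hu ?hv // subrr.
Qed.

Lemma Gam0 K' w : 0%R \in Gam K' w.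
Proof. by rewrite inE; apply/parP => i _; rewrite phi0 symp0l. Qed.

Lemma GamD K' w : {in Gam K' w &, forall u v, (u + v)%R \in Gam K' w}.
Proof.
move=> u v uG vG; rewrite -[v]opprK; apply: GamB => //.
by rewrite -sub0r; apply: GamB => //; apply: Gam0.
Qed.

Lemma card_preim (A : forall i, {set F i * F i}) :
  #|[set w | [forall i in K, phi i w \in A i]]| = \prod_(i in K) #|A i|.
Proof.
pose e (w : V) : {dffun forall i, F i * F i} :=
  [ffun i => if i \in K then phi i w else 0%R].
have eE w i : e w i = if i \in K then phi i w else 0%R by rewrite ffunE.
have eI : injective e.
  move=> u v euv; apply/eqP; rewrite -subr_eq0; apply/eqP/phi_inj => i iK.
  by rewrite phiB; have := congr1 (fun f : {dffun _} => f i) euv; rewrite !eE iK => ->; rewrite subrr.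
pose U (B : forall i, {set F i * F i}) i := if i \in K then B i else [set (0%R : (F i * F i)%type)].
have cU B : #|setXn (U B)| = \prod_(i in K) #|B i|.
  rewrite cardsXn [RHS]big_mkcond /=; apply: eq_bigr => i _; rewrite /U.
  by case: ifP => // _; rewrite cards1.
(* Surjectivity comes from injectivity and equal cardinalities; this is the use of
   [d = 2 * wt K]. *)
have imT : [set e w | w in setT] = setXn (U (fun i => setT)).
  apply/eqP; rewrite eqEcard card_imset // cU cardsT card_mx mul1n card_Fp //.
  apply/andP; split.
    apply/subsetP => _ /imsetP[w _ ->]; apply/setXnP => i; rewrite eE /U.
    by case: ifP; rewrite !inE.
  rewrite [X in _ <= p ^ X]dimE /wt mulnC big_distrl /= expn_sum; apply: leq_prod => i iK.
  by rewrite cardsT card_prod cardF -expnD addnn -muln2.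
rewrite -cU -(card_imset _ eI); congr #|_ : {set _}|; apply/setP => f.
apply/imsetP/setXnP => [[w + ->] i|fU].
  rewrite inE => /'forall_implyP h; rewrite eE /U; case: ifP => [/h//|_]; by rewrite inE.
have : f \in [set e w | w in setT].
  by rewrite imT; apply/setXnP => i; have := fU i; rewrite /U; case: ifP; rewrite !inE.
case/imsetP => w _ fe; exists w => //; rewrite inE; apply/'forall_implyP => i iK.
by have := fU i; rewrite /U iK fe eE iK.
Qed.

Lemma card_Gam K' w : K' \subset K -> nonvan K' w ->
  #|Gam K' w| = p ^ (wt K' + 2 * wt (K :\: K')).
Proof.
move=> KK /nonvanP nw.
pose A i : {set F i * F i} := if i \in K' then [set y | symp y (phi i w) == 0%R] else setT.
have -> : Gam K' w = [set v | [forall i in K, phi i v \in A i]].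
  apply/setP => v; rewrite !inE; apply/'forall_implyP/'forall_implyP => h i iK.
    rewrite /A; case: ifP => iK'; rewrite ?inE //; exact: h.
  by have := h i (subsetP KK i iK); rewrite /A iK inE.
rewrite card_preim (big_setID K') /= (setIidPr KK) expnD; congr (_ * _).
  rewrite /wt expn_sum; apply: eq_bigr => i iK; rewrite /A iK card_line ?nw //.
rewrite /wt mulnC big_distrl /= expn_sum; apply: eq_bigr => i.
rewrite inE => /andP[/negPf iK _]; rewrite /A iK cardsT card_prod cardF -expnD.
by rewrite addnn muln2.
Qed.

Lemma card_vanish I : I \subset K -> #|vanish I| = p ^ (2 * wt (K :\: I)).
Proof.
move=> KK.
pose A i : {set F i * F i} := if i \in I then [set (0%R : (F i * F i)%type)] else setT.
have -> : vanish I = [set v | [forall i in K, phi i v \in A i]].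
  apply/setP => v; rewrite !inE; apply/'forall_implyP/'forall_implyP => h i iK.
    rewrite /A; case: ifP => iK'; rewrite ?inE //; exact: h.
  by have := h i (subsetP KK i iK); rewrite /A iK inE.
rewrite card_preim (big_setID I) /= (setIidPr KK) big1 => [|i iI]; last first.
  by rewrite /A iI cards1.
rewrite mul1n /wt mulnC big_distrl /= expn_sum; apply: eq_bigr => i.
rewrite inE => /andP[/negPf iK _]; rewrite /A iK cardsT card_prod cardF -expnD.
by rewrite addnn muln2.
Qed.

Lemma phi_onto i (v : F i * F i) : i \in K ->
  exists w, phi i w = v /\ forall j, j \in K -> j != i -> phi j w = 0%R.
Proof.
move=> iK; pose f := @dfwith _ (fun j : 'I_s => (F j * F j)%type) (fun j => 0%R) i v.
have : 0 < #|[set w | [forall j in K, phi j w \in [set f j]]]|.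
  by rewrite card_preim prodn_gt0 // => j; rewrite cards1.
rewrite card_gt0 => /set0Pn[w]; rewrite inE => /'forall_implyP h; exists w; split.
  by have := h i iK; rewrite inE /f dfwith_in => /eqP.
by move=> j jK ji; have := h j jK; rewrite inE /f dfwith_out 1?eq_sym // => /eqP.
Qed.

End Good.
End Dim.
End Forms.

(* The nonzero functionals [tau] play the role of the traces to the prime field. *)
Definition field_system (p s : nat) (F : 'I_s -> finFieldType) (kk : 'I_s -> nat)
  (tau : forall i, F i -> 'F_p) : Prop :=
  [/\ prime p, forall i, #|F i| = p ^ kk i, forall i, 0 < kk i,
      forall i x y, tau i (x - y)%R = (tau i x - tau i y)%R
    & forall i, exists x, tau i x != 0%R].

Definition lg (p : nat) : nat := (trunc_log 2 p).+1.

(** The constants depend on [k] alone, so the systems may vary in the induction. The range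
    [m ^ 2 <= 4 * p] leaves room for the radius [H + 1], with [H] up to the square root of [p]. *)
Definition energy_bound (k C e : nat) : Prop :=
  forall (p s : nat) (F : 'I_s -> finFieldType) (kk : 'I_s -> nat)
    (tau : forall i, F i -> 'F_p), field_system kk tau ->
  forall (K : {set 'I_s}) (d : nat) (phi : forall i, 'rV['F_p]_d -> F i * F i)
    (a : 'rV['F_p]_d) (m : nat),
    good kk phi K -> wt kk K = k -> 0 < m -> m ^ 2 <= 4 * p ->
    energy phi K (tbox a m) <= C * m ^ (2 * k) * lg p ^ e.

Lemma relpairs_transfer (T T' : finType) (R : rel T) (R' : rel T') (h : T -> T')
  (X : {set T}) (Y : {set T'}) :
  {in X &, injective h} -> {in X, forall x, h x \in Y} ->
  {in X &, forall x y, R x y = R' (h x) (h y)} -> relpairs R X X <= relpairs R' Y Y.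
Proof.
move=> hI hY hR; apply: leq_trans (_ : relpairs R' (h @: X) (h @: X) <= _).
  rewrite /relpairs big_imset //=; apply: leq_sum => x xX.
  by rewrite big_imset //=; apply: leq_sum => y yX; rewrite hR.
by apply: relpairs_sub; apply/subsetP => _ /imsetP[x xX ->]; apply: hY.
Qed.

Lemma additive_row_form (p : nat) (d : nat) (f : 'rV['F_p]_d -> 'F_p) :
  (forall u v, f (u - v) = f u - f v)%R ->
  forall v, (f v = \sum_j v ord0 j * f (delta_mx 0 j))%R.
Proof.
move=> fB.
have f0 : f 0%R = 0%R by rewrite -(subrr (0%R : 'rV['F_p]_d)) fB subrr.
have fD u v : f (u + v)%R = (f u + f v)%R.
  by rewrite -{1}[v]opprK -[(- v)%R]sub0r !fB f0 sub0r opprK.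
have fMn u n : f (u *+ n)%R = (f u *+ n)%R.
  by elim: n => [|n IH]; rewrite ?mulr0n ?f0 // !mulrS fD IH.
move=> v; rewrite {1}(row_sum_delta v).
have -> : f (\sum_j v ord0 j *: delta_mx 0 j)%R = (\sum_j f (v ord0 j *: delta_mx 0 j))%R.
  by apply: (big_morph f fD f0).
apply: eq_bigr => j _; rewrite -[v ord0 j]natr_Zp scaler_nat fMn.
by rewrite natr_Zp -mulr_natl natr_Zp.
Qed.

(** * Duality, restriction to blocks, and mixed sums *)

Section System.
Variables (p s : nat) (F : 'I_s -> finFieldType) (kk : 'I_s -> nat).
Variable tau : forall i, F i -> 'F_p.
Hypothesis sys : field_system kk tau.

Let p_pr : prime p. Proof. by case: sys. Qed.
Let cardF i : #|F i| = p ^ kk i. Proof. by case: sys. Qed.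

Lemma tau0 i : tau (0%R : F i) = 0%R.
Proof. by case: sys => _ _ _ tB _; rewrite -(subrr (0%R : F i)) tB subrr. Qed.

Section Dual.
Variables (d : nat) (phi : forall i, 'rV['F_p]_d -> F i * F i) (K : {set 'I_s}).
Hypothesis gK : good kk phi K.
Local Notation V := 'rV['F_p]_d.

(** A nondegenerate alternating F_p-valued form for which the class of a nonvanishing vector is its
    own orthogonal complement. [trdual] translates it into the standard dot product. *)
Definition trform (v w : V) : 'F_p := (\sum_(i in K) tau (symp (phi i v) (phi i w)))%R.
Definition trdual (w : V) : V := (\row_j trform (delta_mx 0 j) w)%R.

Lemma dot_trdual (v w : V) : dotv v (trdual w) = trform v w.
Proof.
rewrite (@additive_row_form p d (trform^~ w)) /dotv; first by apply: eq_bigr => j _; rewrite mxE.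
case: sys => _ _ _ tB _ u u'; rewrite /trform -sumrB; apply: eq_bigr => i _.
by rewrite (phiB gK) sympBl tB.
Qed.

Lemma trdualB (u v : V) : trdual (u - v)%R = (trdual u - trdual v)%R.
Proof.
case: sys => _ _ _ tB _; apply/rowP => j; rewrite !mxE /trform -sumrB.
by apply: eq_bigr => i _; rewrite (phiB gK) sympBr tB.
Qed.

Lemma trform_block (v w : V) i : i \in K -> (forall j, j \in K -> j != i -> phi j v = 0%R) ->
  trform v w = tau (symp (phi i v) (phi i w)).
Proof.
move=> iK h; rewrite /trform (bigD1 i) //= big1 ?addr0 // => j /andP[jK ji].
by rewrite h // symp0l tau0.
Qed.

Lemma trdual_inj : injective trdual.
Proof.
suff h w : trdual w = 0%R -> w = 0%R.
  by move=> u v e; apply/eqP; rewrite -subr_eq0; apply/eqP/h; rewrite trdualB e subrr.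
move=> w0; apply: (phi_inj gK) => i iK; apply/eqP; apply: contraT => nz.
have [y ny] := symp_nondeg nz; have [c nc] : exists c, tau (c : F i) != 0%R by case: sys.
(* Rescaling [y] gives the determinant the value [c], on which the functional [tau] does not
   vanish. *)
pose b := (c / symp y (phi i w))%R.
have [v [vi vj]] := phi_onto p_pr cardF gK ((b * y.1)%R, (b * y.2)%R) iK.
have := dot_trdual v w; rewrite w0 (trform_block w iK vj) vi symp_scale_l divfK //.
rewrite /dotv big1 => [e|j _]; last by rewrite mxE mulr0.
by rewrite -e eqxx in nc.
Qed.

(* Replacing [phi] by [phi \o trdual^-1] turns the dual lattice of [Gam K w] into the
   lattice of the same class. *)
Lemma dual_forms : exists (phi' : forall i, V -> F i * F i) (T : V -> V),
  [/\ good kk phi' K, injective T, forall i w, phi' i (T w) = phi i w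
    & forall w, nonvan phi K w -> orthv (Gam phi K w) = Gam phi' K (T w)].
Proof.
pose inv := invF trdual_inj.
have iK : cancel trdual inv by apply: invF_f.
have Ki : cancel inv trdual by apply: f_invF.
exists (fun i w => phi i (inv w)), trdual; split.
- split; last exact: dimE gK.
    move=> i u v; rewrite -(phiB gK); congr phi; apply: trdual_inj.
    by rewrite trdualB !Ki.
  move=> w h; rewrite -[w]Ki (phi_inj gK h).
  by have := trdualB 0%R 0%R; rewrite !subrr.
- exact: trdual_inj.
- by move=> i w; rewrite iK.
move=> w nw; apply/setP => x; rewrite -[x]Ki; set v := inv x.
rewrite [in RHS]inE; apply/idP/parP => [|h]; last first.
  rewrite inE; apply/'forall_implyP => g; rewrite inE => /parP gw.
  rewrite dot_trdual /trform big1 // => i iK'.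
  suff -> : symp (phi i g) (phi i v) = 0%R by apply: tau0.
  have nwi : phi i w != 0%R by move/nonvanP: nw; apply.
  apply: (symp_trans nwi (gw i iK')); apply/eqP; rewrite symp_eq0C.
  by have := h i iK'; rewrite !iK => ->.
rewrite inE => /'forall_implyP h i iK'; rewrite !iK; apply/eqP; rewrite symp_eq0C.
apply: contraT => nz; have [c nc] : exists c, tau (c : F i) != 0%R by case: sys.
pose b := (c / symp (phi i w) (phi i v))%R.
have [g [gi gj]] := phi_onto p_pr cardF gK ((b * (phi i w).1)%R, (b * (phi i w).2)%R) iK'.
have /h : g \in Gam phi K w.
  rewrite inE; apply/parP => j jK; case: (eqVneq j i) => [->|ji]; last by rewrite gj // symp0l.
  by rewrite gi symp_scale_l sympxx mulr0.
by rewrite dot_trdual (trform_block v iK' gj) gi symp_scale_l divfK // (negPf nc).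
Qed.

End Dual.

Section Restrict.
Variables (d : nat) (phi : forall i, 'rV['F_p]_d -> F i * F i) (K : {set 'I_s}).
Hypothesis gK : good kk phi K.
Local Notation V := 'rV['F_p]_d.

Lemma vanish0 I : 0%R \in vanish phi I.
Proof. by apply/vanishP => i _; rewrite (phi0 gK). Qed.

Lemma vanishD I : {in vanish phi I &, forall u v, (u + v)%R \in vanish phi I}.
Proof.
by move=> u v /vanishP hu /vanishP hv; apply/vanishP => i iI; rewrite (phiD gK) hu ?hv ?addr0.
Qed.

Lemma colsub_tbox (r : nat) (f : 'I_r -> 'I_d) (a w : V) m : w \in tbox a m ->
  colsub f w \in tbox (colsub f a) m.
Proof. by rewrite !inE => /forallP h; apply/forallP => j; have := h (f j); rewrite !mxE. Qed.

(** The vectors vanishing on [I] form a space of dimension [2 * wt (K :\: I)]. Reading them through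
    that many of their coordinates keeps boxes and gives a good system on the remaining blocks. *)
Lemma energy_vanish (I K' : {set 'I_s}) (a : V) (m : nat) :
  I \subset K -> K' \subset K :\: I ->
  exists r (phi' : forall i, 'rV['F_p]_r -> F i * F i) (a' : 'rV['F_p]_r),
    good kk phi' (K :\: I) /\
    energy phi K' (vanish phi I :&: tbox a m) <= energy phi' K' (tbox a' m).
Proof.
move=> IK KK.
have [r [f [B [cV Bf uB wB]]]] := subgroup_coords p_pr (vanish0 I) (@vanishD I).
exists r, (fun i u => phi i (u *m B)%R), (colsub f a); split.
  split.
  - by move=> i u v; rewrite mulmxBl (phiB gK).
  - move=> u h; have : (u *m B)%R = 0%R.
      apply: (phi_inj gK) => i iK; case: (boolP (i \in I)) => iI.
        by have /vanishP := uB u; apply.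
      by apply: h; rewrite inE iI.
    by move/(congr1 (colsub f)); rewrite -mulmx_colsub Bf mulmx1 => ->; apply/rowP => j; rewrite !mxE.
  - move: cV; rewrite (card_vanish p_pr cardF gK IK) => /eqP.
    by rewrite eqn_exp2l ?prime_gt1 // => /eqP.
have sub w : w \in nvset phi K' (vanish phi I :&: tbox a m) ->
    [/\ w \in vanish phi I, w \in tbox a m & nonvan phi K' w].
  by rewrite [w \in nvset _ _ _]inE => /andP[/setIP[]].
apply: (relpairs_transfer (h := colsub f)).
- by move=> u v /sub[uV _ _] /sub[vV _ _] e; rewrite (wB u uV) (wB v vV) e.
- move=> w /sub[wV wX nw]; rewrite inE colsub_tbox //=.
  by apply/nonvanP => i iK; rewrite -wB //; move/nonvanP: nw; apply.
- by move=> u v /sub[uV _ _] /sub[vV _ _]; rewrite /par -!wB.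
Qed.

(** The blocks outside [K'] are discarded by fixing the coordinates [f1] that parametrize
    [vanish K']. Each fibre is, up to a translation invisible to [K'], a box in a complement of
    [vanish K'], where the forms of [K'] are a good system. Combining fibres by [relpairs_cover]
    squares their number. *)
Lemma energy_fibers (K' : {set 'I_s}) (a : V) (m C e : nat) :
  K' \subset K -> energy_bound (wt kk K') C e -> 0 < m -> m ^ 2 <= 4 * p ->
  energy phi K' (tbox a m) <=
  ((2 * m) ^ (2 * wt kk (K :\: K'))) ^ 2 * (C * m ^ (2 * wt kk K') * lg p ^ e).
Proof.
move=> KK EB m0 mp.
have [r1 [f1 [B1 [cU Bf1 uB1 wB1]]]] := subgroup_coords p_pr (vanish0 K') (@vanishD K').
have r1E : r1 = 2 * wt kk (K :\: K').
  by move: cU; rewrite (card_vanish p_pr cardF gK KK) => /eqP; rewrite eqn_exp2l ?prime_gt1 // => /eqP.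
pose W0 : {set V} := [set w : V | colsub f1 w == 0%R].
have c0 : colsub f1 (0%R : V) = 0%R by apply/rowP => j; rewrite !mxE.
have cD (u v : V) : colsub f1 (u + v)%R = (colsub f1 u + colsub f1 v)%R by apply/rowP => j; rewrite !mxE.
have cB (u v : V) : colsub f1 (u - v)%R = (colsub f1 u - colsub f1 v)%R by apply/rowP => j; rewrite !mxE.
have W00 : 0%R \in W0 by rewrite inE c0.
have W0D : {in W0 &, forall u v, (u + v)%R \in W0}.
  by move=> u v; rewrite !inE cD => /eqP-> /eqP->; rewrite addr0.
have [r2 [f2 [B2 [cW Bf2 uB2 wB2]]]] := subgroup_coords p_pr W00 W0D.
have projW w : (w - colsub f1 w *m B1)%R \in W0.
  by rewrite inE cB -mulmx_colsub Bf1 mulmx1 subrr.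
have r12 : r1 + r2 = d.
  have : #|vanish phi K'| * #|W0| = p ^ d.
    rewrite -cardsX.
    pose g (w : V) := ((colsub f1 w *m B1)%R, (w - colsub f1 w *m B1)%R).
    have gI : injective g by move=> u v [] e1; rewrite e1 => /addIr.
    have := card_imset setT gI; rewrite cardsT card_mx mul1n card_Fp // => <-.
    congr #|_ : {set _}|; apply/setP => [[x y]]; apply/setXP/imsetP => /= [[xU yW]|[w _ [-> ->]]].
      exists (x + y)%R => //; rewrite /g cD; move: yW; rewrite inE => /eqP ->.
      by rewrite addr0 -wB1 // addrAC subrr add0r.
    by split=> //; apply: uB1.
  by rewrite cU cW -expnD => /eqP; rewrite eqn_exp2l ?prime_gt1 // => /eqP.
pose phi' i (u : 'rV['F_p]_r2) := phi i (u *m B2)%R.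
have g' : good kk phi' K'.
  split.
  - by move=> i u v; rewrite /phi' mulmxBl (phiB gK).
  - move=> u h; have uU : (u *m B2)%R \in vanish phi K' by apply/vanishP.
    have := wB1 _ uU; have := uB2 u; rewrite inE => /eqP -> /(congr1 (colsub f2)).
    rewrite mul0mx -mulmx_colsub Bf2 mulmx1 => ->; apply/rowP => j; by rewrite !mxE.
  - have := dimE gK; rewrite (wtD kk KK); lia.
(* Cells of side 1 make [t] fix the coordinates [f1] exactly; [.-1.+1] only supplies the successor
   that [inord] requires. *)
pose t (w : V) : {ffun 'I_r1 -> 'I_(2 * m).-1.+1} :=
  [ffun j => inord (cell m 1 ((w - a)%R ord0 (f1 j)))].
rewrite /energy -r1E.
apply: leq_trans (relpairs_cover (@par_relE _ _ _ _ _ K') (t := t)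
  (M := C * m ^ (2 * wt kk K') * lg p ^ e) (nvset_subT _ _ _) _) _; last first.
  by rewrite card_ffun !card_ord prednK // muln_gt0.
move=> x; set Xt := [set w in _ | _].
case: (set_0Vmem Xt) => [->|[w0 w0X]]; first by rewrite /relpairs big_set0.
have sub w : w \in Xt -> [/\ w \in tbox a m, nonvan phi K' w & t w = x].
  by rewrite [w \in Xt]inE => /andP[+ /eqP ->]; rewrite [w \in nvset _ _ _]inE => /andP[-> ->].
have cst w : w \in Xt -> colsub f1 w = colsub f1 w0.
  move=> /sub[wX _ wt]; have [w0m _ w0t] := sub w0 w0X.
  apply/rowP => j; rewrite !mxE.
  have : t w j = t w0 j by rewrite wt w0t.
  move: wX w0m; rewrite !inE => /forallP/(_ (f1 j)) h /forallP/(_ (f1 j)) h0.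
  rewrite !ffunE => /(congr1 (@nat_of_ord _)); rewrite !inordK.
  - move/(cell_close p_pr (isT : 0 < 1) h h0) => hc.
    have : lft ((w - a)%R ord0 (f1 j)) = lft ((w0 - a)%R ord0 (f1 j)).
      by move: hc; move: (lft _) (lft _) => y y'; lia.
    by move/(congr1 (fun z : int => z%:~R : 'F_p)%R); rewrite !lftK // !mxE => /addIr.
  - by rewrite prednK ?muln_gt0 //; apply: cell_lt => //; rewrite muln1.
  - by rewrite prednK ?muln_gt0 //; apply: cell_lt => //; rewrite muln1.
(* The element of [vanish K'] with the common [f1] coordinates: subtracting it lands in [W0] and
   changes no form of [K']. *)
pose z := (colsub f1 w0 *m B1)%R.
have zU : z \in vanish phi K' by apply: uB1.
have inW w : w \in Xt -> (w - z)%R \in W0 by move=> wX; rewrite /z -(cst w wX).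
have phz w i : w \in Xt -> i \in K' -> phi' i (colsub f2 (w - z)%R) = phi i w.
  move=> wX iK; rewrite /phi' -wB2 ?inW // (phiB gK).
  by have /vanishP -> := zU; rewrite // subr0.
apply: leq_trans (EB _ _ _ _ _ sys K' r2 phi' (colsub f2 (a - z)%R) m g' erefl m0 mp).
apply: (relpairs_transfer (h := fun w => colsub f2 (w - z)%R)).
- move=> u v uX vX /(congr1 (fun y => y *m B2)%R); rewrite -!wB2 ?inW // => /addIr //.
- move=> w wX; have [wb nw _] := sub w wX; rewrite inE; apply/andP; split.
    apply: colsub_tbox; move: wb; rewrite !inE.
    by have -> : (w - z - (a - z) = w - a)%R by rewrite opprB addrA subrK.
  by apply/nonvanP => i iK; rewrite phz //; move/nonvanP: nw; apply.
- move=> u v uX vX; apply/parP/parP => h i iK; move: (h i iK); by rewrite !phz.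
Qed.

End Restrict.

Section Sums.
Variables (d : nat) (phi : forall i, 'rV['F_p]_d -> F i * F i) (K : {set 'I_s}).
Hypothesis gK : good kk phi K.
Local Notation V := 'rV['F_p]_d.

Lemma sub_energy (I K' : {set 'I_s}) (a : V) (m C e : nat) :
  I \subset K -> K' \subset K :\: I -> energy_bound (wt kk K') C e ->
  0 < m -> m ^ 2 <= 4 * p ->
  energy phi K' (vanish phi I :&: tbox a m) <=
  (2 * m) ^ (4 * wt kk (K :\: I :\: K')) * (C * m ^ (2 * wt kk K') * lg p ^ e).
Proof.
move=> IK KK EB m0 mp; have [r [phi' [a' [g' h]]]] := energy_vanish gK a m IK KK.
apply: leq_trans h (leq_trans (energy_fibers g' a' KK EB m0 mp) _).
by rewrite -expnM; set x := wt _ _; have -> : 2 * x * 2 = 4 * x by lia.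
Qed.

Lemma card_le_wt (J : {set 'I_s}) : #|J| <= wt kk J.
Proof. by rewrite -sum1_card; apply: leq_sum => i _; case: sys. Qed.

(** For nonvanishing [w] this set shrinks from [K] at [q = 1] to the empty set at [q = p]; the
    dyadic argument uses the scale at which it becomes empty. *)
Definition Izero (q : nat) (w : V) : {set 'I_s} :=
  [set i in K | [forall h in Gam phi K w :&: box p d q, phi i h == 0%R]].

Lemma IzeroS q w : Izero q w \subset K.
Proof. by apply/subsetP => i; rewrite inE => /andP[]. Qed.

Lemma phiMn_eq0 i (g : V) n : 0 < n < p -> phi i (g *+ n)%R = 0%R -> phi i g = 0%R.
Proof.
move=> /andP[n0 np] h.
have nz : (n%:R != 0 :> 'F_p)%R.
  by rewrite -(dvdn_pcharf (pchar_Fp p_pr)) gtnNdvd.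
pose m : nat := (n%:R^-1 : 'F_p)%R.
have -> : g = (g *+ n *+ m)%R.
  by rewrite -!scaler_nat /m natr_Zp scalerA mulVf // scale1r.
by rewrite (phiMn gK) h mul0rn.
Qed.

(** Pigeonhole: if all [#|K| + 1] shifts fail, two of them vanish in the same block. Their
    difference is a multiple of [g] by an integer below [p], so [g] and then [h] vanish in that
    block, which excludes both [i] and the blocks of [S]. *)
Lemma nonvan_shift (S : {set 'I_s}) (i : 'I_s) (h g : V) :
  i \in K -> S \subset K -> #|K| < p -> nonvan phi S h -> phi i g != 0%R ->
  exists t : 'I_(#|K|.+1), nonvan phi (i |: S) (h + g *+ t)%R.
Proof.
move=> iK SK Kp /nonvanP nh ng; apply/existsP; apply: contraT; rewrite negb_exists => /forallP bad.
have pick_bad (t : 'I_(#|K|.+1)) : {j | j \in i |: S & phi j (h + g *+ t)%R == 0%R}.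
  apply: sig2W; have := bad t; rewrite negb_forall => /existsP[j].
  by rewrite negb_imply negbK => /andP[jS e]; exists j.
pose f t := s2val (pick_bad t).
have fK : {subset codom f <= mem K}.
  move=> _ /codomP[t ->]; have := s2valP (pick_bad t); rewrite /f !inE.
  by case/orP => [/eqP->//|/(subsetP SK)].
have /injectivePn[t1 [t2 t12 ft]] : ~~ injectiveb f.
  apply/negP => /injectiveP fI; have := card_codom fI; rewrite card_ord => cf.
  have := subset_leq_card (introT subsetP fK); rewrite cf ltnn //.
wlog lt12 : t1 t2 t12 ft / t1 < t2.
  move=> W; case: (ltngtP t1 t2) => [h1|h1|h1]; [exact: (W t1 t2)|apply: (W t2 t1) => //|].
    by rewrite eq_sym.
  by move/val_inj: h1 => h1; rewrite h1 eqxx in t12.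
have jS := s2valP (pick_bad t1); have /eqP e1 := s2valP' (pick_bad t1).
have /eqP e2 := s2valP' (pick_bad t2); rewrite -/(f t2) -ft /f in e2.
set j := s2val (pick_bad t1) in jS e1 e2.
have gj : phi j g = 0%R.
  apply: (@phiMn_eq0 j g (t2 - t1)).
    rewrite subn_gt0 lt12 /=; apply: leq_ltn_trans (leq_subr _ _) (leq_ltn_trans _ Kp).
    by rewrite -ltnS ltn_ord.
  rewrite mulrnBr ?(ltnW lt12) //.
  have -> : (g *+ t2 - g *+ t1 = (h + g *+ t2) - (h + g *+ t1))%R.
    by rewrite opprD addrACA subrr add0r.
  by rewrite (phiB gK) e1 e2 subrr.
case/setU1P: jS => [ji|jS]; first by rewrite ji in gj; rewrite gj eqxx in ng.
by have := nh j jS; move: e1; rewrite (phiD gK) (phiMn gK) gj mul0rn addr0 => ->; rewrite eqxx.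
Qed.

(** Blocks are made nonzero one at a time by adding to [h] a multiple of a point that is nonzero in
    the new block. For a given multiple the map is a translation, so at most [#|K| + 1] points share
    an image; the radius grows by [#|K| * q]. *)
Lemma proportion_step (q : nat) (w : V) (S : {set 'I_s}) :
  #|K| < p -> S \subset K :\: Izero q w ->
  #|Gam phi K w :&: box p d q| <= #|K|.+1 ^ #|S| *
  #|[set h in Gam phi K w :&: box p d (q + #|S| * (#|K| * q)) |
      (h \in vanish phi (Izero q w)) && nonvan phi S h]|.
Proof.
move=> Kp; have [n] := ubnP #|S|; elim: n S => // n IH S /ltnSE leSn SK.
have vanI h : h \in Gam phi K w :&: box p d q -> h \in vanish phi (Izero q w).
  move=> hG; apply/vanishP => i; rewrite inE => /andP[_ /'forall_implyP/(_ h hG)/eqP //].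
case: (set_0Vmem S) => [->|[i iS]].
  rewrite cards0 mul1n mul0n addn0; apply: subset_leq_card; apply/subsetP => h hG.
  by rewrite inE hG vanI //=; apply/nonvanP => i; rewrite inE.
have SE : S = i |: (S :\ i) by rewrite setD1K.
have cS : #|S| = #|S :\ i|.+1 by rewrite (cardsD1 i) iS.
have iKI := subsetP SK i iS; move: iKI; rewrite inE => /andP[iI iK].
have [g gG ng] : exists2 g, g \in Gam phi K w :&: box p d q & phi i g != 0%R.
  move: iI; rewrite inE iK negb_forall => /existsP[g]; rewrite negb_imply => /andP[gG ng].
  by exists g.
have SK' : S :\ i \subset K :\: Izero q w by apply: subset_trans SK; apply: subsetDl.
apply: leq_trans (IH (S :\ i) _ SK') _; first by rewrite -cS.
rewrite cS expnSr -mulnA leq_mul2l; apply/orP; right.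
set A := [set h in _ | _]; set A' := [set h in _ | _].
pose t (h : V) : 'I_(#|K|.+1) := odflt ord0 [pick t : 'I_(#|K|.+1) | nonvan phi S (h + g *+ t)%R].
apply: leq_trans (card_fiber_le (f := t) (N := #|A'|) _) _; last by rewrite card_ord.
move=> x; have tI : injective (fun h : V => h + g *+ x)%R by apply: addIr.
rewrite -(card_imset _ tI); apply: subset_leq_card; apply/subsetP => _ /imsetP[h + ->].
rewrite inE => /andP[+ /eqP tx]; rewrite [h \in A]inE => /andP[/setIP[hG hb] /andP[hv hn]].
have /setIP[gG' gb] := gG.
rewrite [_ \in A']inE; apply/andP; split; last (apply/andP; split).
- apply/setIP; split.
    apply: (GamD gK) => //; elim: (nat_of_ord x) => [|y IHy]; first by rewrite mulr0n (Gam0 gK).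
    by rewrite mulrS (GamD gK).
  have -> : q + #|S :\ i|.+1 * (#|K| * q) = q + #|S :\ i| * (#|K| * q) + #|K| * q.
    by rewrite mulSn addnCA addnC.
  by apply: box_addMn => //; rewrite -ltnS ltn_ord.
- apply/vanishP => j jI; rewrite (phiD gK) (phiMn gK).
  by move/vanishP: hv => ->//; move/vanI/vanishP: gG => ->//; rewrite mul0rn addr0.
- rewrite -tx /t; case: pickP => [//|none].
  have SK2 : S :\ i \subset K by apply: subset_trans SK' (subsetDl _ _).
  have [t0] := nonvan_shift iK SK2 Kp hn ng; rewrite -SE => ht.
  by have := none t0; rewrite ht.
Qed.

(* The factor [1 + k * k] is lost in [proportion]; the term [32 * k] leaves room for the
   dual box of [dual_box_count]. *)
Definition c0 (k : nat) : nat := 1 + k * k + 32 * k.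

Lemma proportion (k q : nat) (w : V) : wt kk K = k -> k < p ->
  #|Gam phi K w :&: box p d q| <= k.+1 ^ k *
  #|[set h in Gam phi K w :&: box p d (c0 k * q) |
      (h \in vanish phi (Izero q w)) && nonvan phi (K :\: Izero q w) h]|.
Proof.
move=> wk kp; have Kk : #|K| <= k by rewrite -wk card_le_wt.
have Kp := leq_ltn_trans Kk kp.
apply: leq_trans (proportion_step Kp (subxx _)) _; set S := K :\: _.
have Sk : #|S| <= k by apply: leq_trans Kk; apply: subset_leq_card; apply: subsetDl.
apply: leq_mul; first by apply: (@leq_trans (k.+1 ^ #|S|)); [apply: leq_pow|rewrite leq_pexp2l].
have bS : box p d (q + #|S| * (#|K| * q)) \subset box p d (c0 k * q).
  apply: box_sub; rewrite /c0; have := leq_mul Sk Kk.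
  by move: #|S| #|K| => x y; rewrite mulnA => h; have := leq_mul h (leqnn q); lia.
apply: subset_leq_card; apply/subsetP => h; rewrite inE => /andP[/setIP[hG hb] hh].
by rewrite inE hh andbT; apply/setIP; split=> //; apply: (subsetP bS).
Qed.

Section Mixed.
Variables (k C e : nat).
Hypotheses (wk : wt kk K = k) (kp : k < p).
Hypothesis IH : forall k', k' < k -> energy_bound k' C e.

Lemma wt_proper (I : {set 'I_s}) : I \subset K -> I != set0 -> wt kk (K :\: I) < k.
Proof.
move=> IK /set0Pn[i iI]; rewrite -wk (wtD kk IK) -[X in X < _]add0n ltn_add2r.
by apply: leq_trans (card_le_wt I); rewrite card_gt0; apply/set0Pn; exists i.
Qed.

(** [proportion] replaces the points counted by those vanishing exactly on the blocks of [I], giving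
    pairs parallel on [K']. Cauchy-Schwarz separates the two sides: the full box costs
    [(2 * m) ^ (4 * wt I)] over the energy for [K'], the vanishing side costs nothing, and the
    square root restores the exponent [2 * k]. *)
Lemma mixed_sum1 (I : {set 'I_s}) (a : V) (q m : nat) :
  I \subset K -> I != set0 -> c0 k * q <= m -> 0 < m -> m ^ 2 <= 4 * p ->
  \sum_(g in nvset phi K (tbox a m) | Izero q g == I) #|Gam phi K g :&: box p d q| <=
  k.+1 ^ k * (4 ^ k * (C * m ^ (2 * k) * lg p ^ e)).
Proof.
move=> IK I0 cq m0 mp; set K' := K :\: I.
have EB : energy_bound (wt kk K') C e by apply/IH/wt_proper.
set X1 := nvset phi K' (tbox a m); set X2 := nvset phi K' (vanish phi I :&: tbox 0%R m).
apply: (@leq_trans (k.+1 ^ k * relpairs (par phi K') X1 X2)).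
  rewrite /relpairs big_distrr /= big_mkcondr /= [X in _ <= X](big_setID (nvset phi K (tbox a m))) /=.
  have sX : nvset phi K (tbox a m) \subset X1.
    apply/subsetP => g; rewrite !inE => /andP[-> ng] /=.
    by apply: nonvan_subset ng; apply: subsetDl.
  rewrite (setIidPr sX) (leq_trans _ (leq_addr _ _)) //; apply: leq_sum => g _.
  case: ifP => // /eqP gI; apply: leq_trans (proportion q g wk kp) _; rewrite gI.
  rewrite leq_mul2l; apply/orP; right; rewrite -sum1_card big_mkcond [X in _ <= X]big_mkcond /=.
  apply: leq_sum => h _; case: ifP => //; rewrite inE => /andP[/setIP[hG hb] /andP[hv hn]].
  have -> : h \in X2.
    by rewrite [h \in X2]inE hn andbT inE hv tbox0 (subsetP (box_sub p d cq)).
  rewrite lt0b par_sym; apply: par_subset (subsetDl _ _) _; by move: hG; rewrite inE.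
rewrite leq_mul2l; apply/orP; right; rewrite -leq_sqr.
apply: leq_trans (energy_CS _ _ _ _) _.
have E1 : energy phi K' (tbox a m) <=
    (2 * m) ^ (4 * wt kk I) * (C * m ^ (2 * wt kk K') * lg p ^ e).
  have := @sub_energy set0 K' a m C e (sub0set _) _ EB m0 mp.
  have -> : vanish phi set0 :&: tbox a m = tbox a m.
    apply/setP => w; rewrite [LHS]inE; case: (boolP (w \in tbox a m)); rewrite ?andbF ?andbT // => _.
    by apply/vanishP => i; rewrite inE.
  rewrite setD0 setDDr setDv set0U (setIidPr IK); apply; exact: subsetDl.
have E2 : energy phi K' (vanish phi I :&: tbox 0%R m) <= C * m ^ (2 * wt kk K') * lg p ^ e.
  apply: leq_trans (sub_energy 0%R IK (subxx _) EB m0 mp) _.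
  by rewrite setDv {1}/wt big_set0 muln0 mul1n.
apply: leq_trans (leq_mul E1 E2) _.
have kE : k = wt kk I + wt kk K' by rewrite -wk (wtD kk IK).
set x := wt kk I in kE *; set y := wt kk K' in kE *.
have -> : (2 * m) ^ (4 * x) * (C * m ^ (2 * y) * lg p ^ e) * (C * m ^ (2 * y) * lg p ^ e) =
   (4 ^ x * (C * m ^ (2 * k) * lg p ^ e)) ^ 2.
  have -> : (2 * m) ^ (4 * x) = (4 ^ x * m ^ (2 * x)) ^ 2.
    have -> : 4 * x = 2 * x * 2 by lia.
    by rewrite expnM; congr (_ ^ 2); rewrite expnM (expnMn 2 m 2) (expnMn (2 ^ 2)) -(expnM m).
  by rewrite kE mulnDr expnD; ring.
by rewrite leq_sqr leq_mul // leq_pexp2l // kE leq_addr.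
Qed.

Definition cmix : nat := 2 ^ k * (k.+1 ^ k * (4 ^ k * C)).

Lemma mixed_sum (a : V) (q m : nat) :
  c0 k * q <= m -> 0 < m -> m ^ 2 <= 4 * p ->
  \sum_(g in nvset phi K (tbox a m) | Izero q g != set0) #|Gam phi K g :&: box p d q| <=
  cmix * m ^ (2 * k) * lg p ^ e.
Proof.
move=> cq m0 mp.
rewrite (partition_big (Izero q) (fun I => (I \in powerset K) && (I != set0))) /=; last first.
  by move=> g /andP[_ ->]; rewrite powersetE IzeroS.
apply: (@leq_trans (\sum_(I in powerset K) k.+1 ^ k * (4 ^ k * (C * m ^ (2 * k) * lg p ^ e)))).
  rewrite big_mkcondr /=; apply: leq_sum => I; rewrite powersetE => IK.
  case: ifP => // I0; apply: leq_trans (mixed_sum1 a IK I0 cq m0 mp).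
  by apply/eq_leq/eq_bigl => g; case: (eqVneq (Izero q g) I) => [->|_]; rewrite ?andbF // I0 !andbT.
rewrite sum_nat_const card_powerset /cmix -!mulnA leq_mul2r; apply/orP; right.
by rewrite leq_pexp2l // -wk card_le_wt.
Qed.

End Mixed.
End Sums.
End System.

Lemma relpairs_card (T : finType) (R : rel T) (X Y : {set T}) :
  relpairs R X Y <= #|X| * #|Y|.
Proof.
rewrite /relpairs -sum_nat_const; apply: leq_sum => x _; rewrite -sum1_card.
by apply: leq_sum => y _; apply: leq_b1.
Qed.

Lemma sum_bool_card (T : finType) (X : {set T}) (P : pred T) :
  \sum_(x in X) (P x : nat) = #|[set x in X | P x]|.
Proof.
rewrite -sum1_card [RHS](eq_bigl (fun x => (x \in X) && P x)); last by move=> x; rewrite inE.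
by rewrite [RHS]big_mkcondr /=; apply: eq_bigr => x _; case: (P x).
Qed.

Definition crank (k : nat) : nat := 3 ^ k * (2 * k) ^ (2 * k).

(** * Second moments of the point counts over all classes, for rank at most [k] *)

Section ScaleSums.
Variables (p s : nat) (F : 'I_s -> finFieldType) (kk : 'I_s -> nat).
Variable tau : forall i, F i -> 'F_p.
Hypothesis sys : field_system kk tau.
Let p_pr : prime p. Proof. by case: sys. Qed.
Let cardF i : #|F i| = p ^ kk i. Proof. by case: sys. Qed.

Variables (d : nat) (phi : forall i, 'rV['F_p]_d -> F i * F i) (K : {set 'I_s}).
Hypothesis gK : good kk phi K.
Local Notation V := 'rV['F_p]_d.
Variables (k C e : nat).
Hypotheses (k0 : 0 < k) (wk : wt kk K = k) (kp : k < p).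
Hypothesis IH : forall k', k' < k -> energy_bound k' C e.

Local Notation N q w := #|Gam phi K w :&: box p d q|.
Local Notation rk q w := (lft_rank (Gam phi K w :&: box p d q)).
Local Notation Iz q w := (Izero phi K q w).

Lemma dim2k : d = 2 * k. Proof. by rewrite -wk (dimE gK). Qed.

Lemma NS (q Q : nat) w : q <= Q -> N q w <= N Q w.
Proof. by move=> qQ; apply/subset_leq_card/setIS/box_sub. Qed.

Lemma N_rank_shrink (Q q : nat) (w : V) : 0 < q -> q <= Q -> rk Q w <= k ->
  N Q w * q ^ k <= crank k * Q ^ k * N q w.
Proof.
move=> q0 qQ rQ; apply: leq_trans (rank_cover p_pr (@GamB _ _ _ _ _ _ _ gK K w) k0 q0 qQ rQ) _.
rewrite expnMn; have := doubling p_pr k (@GamB _ _ _ _ _ _ _ gK K w) q0.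
have -> : (2 * k) ^ d = (2 * k) ^ (2 * k) by congr (_ ^ _); exact: dim2k.
move=> h; apply: leq_trans (leq_mul (leqnn _) h) _.
by rewrite /crank; apply: eq_leq; ring.
Qed.

Lemma card_Gam_full w : nonvan phi K w -> #|Gam phi K w| = p ^ k.
Proof.
move=> nw; rewrite (card_Gam p_pr cardF gK (subxx _) nw) setDv wk {1}/wt big_set0.
by rewrite muln0 addn0.
Qed.

Lemma par_Gam_eq (v w : V) : nonvan phi K v -> nonvan phi K w -> par phi K v w ->
  Gam phi K v = Gam phi K w.
Proof. by move=> nv nw h; apply/eqP; rewrite -par_Gam. Qed.

Lemma Izero_eq q (v w : V) : Gam phi K v = Gam phi K w -> Iz q v = Iz q w.
Proof. by rewrite /Izero => ->. Qed.

Lemma nvset_box (m : nat) (w : V) :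
  w \in nvset phi K (tbox 0%R m) = (w \in box p d m) && nonvan phi K w.
Proof. by rewrite inE tbox0. Qed.

Lemma in_nvsetT (w : V) : (w \in nvset phi K setT) = nonvan phi K w.
Proof. by rewrite inE in_setT. Qed.

(** The rank condition shrinks both factors from [Q] to the critical [q]. One becomes a sum over
    nonvanishing [h] parallel to [w], available because [Izero] is empty at [2 * q]. Exchanging sums
    gives [p ^ k] vectors [w] per [h], and the other factor, where [Izero] is nonempty at [q], is a
    mixed sum. *)
Lemma scale_sum1 (q Q : nat) : 0 < q -> 2 * q <= Q -> (c0 k * Q) ^ 2 <= p ->
  \sum_(w in nvset phi K setT |
        [&& Iz q w != set0, Iz (2 * q) w == set0 & rk Q w <= k]) N Q w ^ 2 <=
  crank k ^ 2 * (k.+1 ^ k * (cmix k C * (2 * c0 k) ^ (2 * k))) *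
    (p ^ k * Q ^ (2 * k) * lg p ^ e).
Proof.
move=> q0 qQ cQ; set m := c0 k * (2 * q).
have m0 : 0 < m by rewrite muln_gt0 /c0 /= muln_gt0 q0.
have cqm : c0 k * q <= m by rewrite /m leq_mul2l leq_pmull // orbT.
have mp : m ^ 2 <= 4 * p.
  apply: (@leq_trans ((c0 k * Q) ^ 2)); first by rewrite leq_sqr leq_mul2l qQ orbT.
  by apply: leq_trans cQ _; apply: leq_pmull.
have mix := mixed_sum sys gK wk kp IH 0%R cqm m0 mp.
(* The loss in shrinking is [(Q / q) ^ (2 * k)]; its denominator cancels the [q ^ (2 * k)] hidden in
   [m ^ (2 * k)], so the bound does not depend on [q]. *)
rewrite -(leq_pmul2l (_ : 0 < q ^ (2 * k))); last by rewrite expn_gt0 q0.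
pose P w := [&& Iz q w != set0, Iz (2 * q) w == set0 & rk Q w <= k].
have key w : w \in nvset phi K setT -> P w ->
    q ^ (2 * k) * N Q w ^ 2 <= crank k ^ 2 * Q ^ (2 * k) * (k.+1 ^ k *
    (\sum_(h in nvset phi K (tbox 0%R m) | Iz q h != set0) par phi K h w * N q h)).
  rewrite in_nvsetT => nw /and3P[I1 /eqP I2 rQ].
  have h1 : q ^ (2 * k) * N Q w ^ 2 <= crank k ^ 2 * Q ^ (2 * k) * N q w ^ 2.
    have qQ' : q <= Q by apply: leq_trans qQ; apply: leq_pmull.
    have := N_rank_shrink q0 qQ' rQ; rewrite -leq_sqr !expnMn -!expnM.
    by rewrite [k * 2]mulnC [_ * q ^ _]mulnC.
  apply: leq_trans h1 _; rewrite leq_mul2l; apply/orP; right.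
  have h2 : N q w <= k.+1 ^ k * \sum_(h in nvset phi K (tbox 0%R m)) par phi K h w.
    apply: leq_trans (NS w (leq_pmull q (isT : 0 < 2))) _.
    apply: leq_trans (proportion sys gK (2 * q) w wk kp) _; rewrite I2 setD0.
    rewrite leq_mul2l; apply/orP; right; rewrite sum_bool_card; apply: subset_leq_card.
    apply/subsetP => h; rewrite inE => /andP[/setIP[hG hb] /andP[_ hn]].
    by rewrite inE nvset_box hb hn /=; move: hG; rewrite inE.
  rewrite -mulnn; apply: leq_trans (leq_mul (leqnn _) h2) _.
  rewrite mulnCA leq_mul2l; apply/orP; right.
  rewrite big_distrr /= [X in _ <= X]big_mkcondr /=; apply: leq_sum => h.
  rewrite nvset_box => /andP[_ nh]; case: (boolP (par phi K h w)) => hw; last by rewrite muln0.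
  have eG := par_Gam_eq nh nw hw.
  by rewrite (Izero_eq q eG) I1 eG mul1n muln1.
rewrite big_distrr /=; apply: leq_trans (leq_sum _ _) _.
  by move=> w /andP[]; apply: key.
rewrite -big_distrr /= -big_distrr /=.
set S := (X in _ * (_ * X)).
have hS : S <= p ^ k * (cmix k C * m ^ (2 * k) * lg p ^ e).
  rewrite /S exchange_big /=; apply: leq_trans (leq_mul (leqnn _) mix).
  rewrite big_distrr /=; apply: leq_sum => h; rewrite nvset_box => /andP[/andP[_ nh] _].
  rewrite -big_distrl /= leq_mul2r; apply/orP; right.
  rewrite -(card_Gam_full nh) big_mkcondr /=.
  apply: (@leq_trans (\sum_(w in nvset phi K setT) par phi K h w)).
    by apply: leq_sum => w _; case: ifP.
  rewrite sum_bool_card; apply/subset_leq_card/subsetP => w.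
  by rewrite inE => /andP[_]; rewrite inE par_sym.
apply: leq_trans (leq_mul (leqnn _) (leq_mul (leqnn _) hS)) _.
have -> : m ^ (2 * k) = (2 * c0 k) ^ (2 * k) * q ^ (2 * k).
  by rewrite -expnMn /m; congr (_ ^ _); rewrite mulnCA mulnA.
apply: eq_leq; ring.
Qed.

Definition cscale : nat := crank k ^ 2 * (k.+1 ^ k * (cmix k C * (2 * c0 k) ^ (2 * k))).

Lemma leq_lg (J : nat) : 2 ^ J <= p -> J <= lg p.
Proof.
move=> h; apply: leqW; rewrite -(@trunc_expnK 2 J) //; exact: leq_trunc_log.
Qed.

Lemma scale_sum (J : nat) : (c0 k * 2 ^ J) ^ 2 <= p ->
  \sum_(w in nvset phi K setT | (Iz (2 ^ J) w == set0) && (rk (2 ^ J) w <= k))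
     N (2 ^ J) w ^ 2 <=
  cscale * (p ^ k * (2 ^ J) ^ (2 * k) * lg p ^ e.+1).
Proof.
move=> cQ.
pose cond j w := [&& Iz (2 ^ j) w != set0, Iz (2 * 2 ^ j) w == set0 & rk (2 ^ J) w <= k].
apply: (@leq_trans (\sum_(j < J) \sum_(w in nvset phi K setT | cond j w) N (2 ^ J) w ^ 2)).
  under [X in _ <= X]eq_bigr do rewrite big_mkcondr /=.
  rewrite big_mkcondr exchange_big /=; apply: leq_sum => w _; case: ifP => // /andP[IJ rJ].
  have I1 : Iz (2 ^ 0) w != set0.
    rewrite expn0; have -> : Iz 1 w = K.
      apply/setP => i; rewrite inE andbC; case: (boolP (i \in K)) => iK; rewrite ?andbF ?andbT //.
      apply/'forall_implyP => h; rewrite inE box1 // => /andP[_ /set1P ->].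
      by rewrite (phi0 gK).
    by apply/eqP => Ke; move: k0; rewrite -wk Ke /wt big_set0.
  have ex : exists j, Iz (2 ^ j) w == set0 by exists J.
  case: (ex_minnP ex) => [[|j] Ij jmin]; first by rewrite Ij in I1.
  have jJ : j < J by apply: jmin.
  rewrite (bigD1 (Ordinal jJ)) //= /cond rJ -expnS Ij !andbT.
  by case: eqP => [h|_]; [have := jmin j; rewrite h eqxx ltnn => /(_ isT)|rewrite leq_addr].
have pJ : 2 ^ J <= p.
  apply: leq_trans cQ; rewrite expnMn -mulnn mulnCA -[X in X <= _]muln1.
  by rewrite leq_mul2l muln_gt0 !expn_gt0 /c0 !orbT.
apply: (@leq_trans (\sum_(j < J) cscale * (p ^ k * (2 ^ J) ^ (2 * k) * lg p ^ e))).
  apply: leq_sum => j _; apply: scale_sum1 => //; first by rewrite expn_gt0.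
  by rewrite -expnS leq_pexp2l.
rewrite sum_nat_const card_ord expnS; apply: leq_trans (leq_mul (leq_lg pJ) (leqnn _)) _.
apply: eq_leq; ring.
Qed.

(** Here [w] is controlled only on [K'], so each pair of parallel points belongs to
    [p ^ (wt K' + 2 * wt I)] vectors [w]. With the energy at most about [p ^ wt K'] this totals
    [p ^ (2 * k)], the desired size when the radius is near the square root of [p]. No rank
    condition enters. *)
Lemma sqrt_sum1 (I : {set 'I_s}) (r : nat) : I \subset K -> I != set0 -> 0 < r ->
  (c0 k * r) ^ 2 <= p ->
  \sum_(w in nvset phi K setT | Iz r w == I) N r w ^ 2 <=
  (k.+1 ^ k) ^ 2 * (C * p ^ (2 * k) * lg p ^ e).
Proof.
move=> IK I0 r0 cr; set K' := K :\: I; set m := c0 k * r.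
have EB : energy_bound (wt kk K') C e by apply: IH; apply: (wt_proper sys wk).
have m0 : 0 < m by rewrite muln_gt0 /c0 r0.
have mp : m ^ 2 <= 4 * p by apply: leq_trans cr _; apply: leq_pmull.
set Y := nvset phi K' (vanish phi I :&: tbox 0%R m).
have KK : K' \subset K by apply: subsetDl.
have key w : w \in nvset phi K setT -> Iz r w == I ->
    N r w ^ 2 <= (k.+1 ^ k) ^ 2 *
      \sum_(h in Y) \sum_(h' in Y) par phi K' h h' * par phi K' w h.
  rewrite in_nvsetT => nw /eqP Iw.
  have nw' := nonvan_subset KK nw.
  have h1 : N r w <= k.+1 ^ k * \sum_(h in Y) par phi K' w h.
    apply: leq_trans (proportion sys gK r w wk kp) _; rewrite Iw.
    rewrite leq_mul2l; apply/orP; right; rewrite sum_bool_card; apply: subset_leq_card.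
    apply/subsetP => h; rewrite inE => /andP[/setIP[hG hb] /andP[hv hn]].
    rewrite inE; apply/andP; split.
      by rewrite inE hn andbT inE hv tbox0.
    by rewrite par_sym; apply: par_subset KK _; move: hG; rewrite inE.
  apply: (@leq_trans ((k.+1 ^ k * \sum_(h in Y) par phi K' w h) ^ 2)); first by rewrite leq_sqr.
  rewrite expnMn leq_mul2l; apply/orP; right; rewrite -mulnn big_distrlr /=.
  apply: leq_sum => h _; apply: leq_sum => h' _; rewrite !mulnb.
  case: (boolP (par phi K' w h)) => // a1; case: (boolP (par phi K' w h')) => // a2.
  by rewrite (par_trans nw' _ a2) // par_sym.
apply: leq_trans (leq_sum _ _) _; first by move=> w /andP[]; apply: key.
rewrite -big_distrr leq_mul2l; apply/orP; right => /=.
have kE : k = wt kk I + wt kk K' by rewrite -wk (wtD kk IK).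
apply: (@leq_trans (energy phi K' (vanish phi I :&: tbox 0%R m) * p ^ (wt kk K' + 2 * wt kk I))).
  rewrite exchange_big /= /energy /relpairs big_distrl /=; apply: leq_sum => h.
  rewrite [h \in Y]inE => /andP[_ nh]; rewrite exchange_big big_distrl /=; apply: leq_sum => h' _.
  rewrite -big_distrr leq_mul2l; apply/orP; right => /=.
  have -> : p ^ (wt kk K' + 2 * wt kk I) = #|Gam phi K' h|.
    by rewrite (card_Gam p_pr cardF gK KK nh) setDDr setDv set0U (setIidPr IK).
  rewrite big_mkcondr; apply: (@leq_trans (\sum_(w in nvset phi K setT) par phi K' w h)).
    by apply: leq_sum => w _; case: ifP.
  by rewrite sum_bool_card; apply/subset_leq_card/subsetP => w; rewrite !inE => /andP[].
apply: leq_trans (leq_mul (sub_energy sys gK 0%R IK (subxx _) EB m0 mp) (leqnn _)) _.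
rewrite setDv {1}/wt big_set0 muln0 mul1n.
have h1 : m ^ (2 * wt kk K') <= p ^ wt kk K' by rewrite expnM leq_pow.
set x := wt kk I in kE *; set y := wt kk K' in kE h1 *.
apply: (@leq_trans (C * p ^ y * lg p ^ e * p ^ (y + 2 * x))).
  by rewrite !leq_mul.
rewrite kE; have -> : 2 * (x + y) = y + (y + 2 * x) by lia.
rewrite (expnD p y (y + 2 * x)); apply: eq_leq; ring.
Qed.

Definition csqrt : nat := cscale + 2 ^ k * ((k.+1 ^ k) ^ 2 * C).

Lemma sqrt_sum (J : nat) : (c0 k * 2 ^ J) ^ 2 <= p ->
  \sum_(w in nvset phi K setT | rk (2 ^ J) w <= k) N (2 ^ J) w ^ 2 <=
  csqrt * (p ^ (2 * k) * lg p ^ e.+1).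
Proof.
move=> cQ; rewrite (bigID (fun w => Iz (2 ^ J) w == set0)) /= /csqrt mulnDl leq_add //.
  apply: (@leq_trans (cscale * (p ^ k * (2 ^ J) ^ (2 * k) * lg p ^ e.+1))).
    apply: leq_trans (scale_sum cQ); apply/eq_leq/eq_bigl => w.
    by rewrite -andbA [X in _ && X]andbC.
  have h : (2 ^ J) ^ (2 * k) <= p ^ k.
    by rewrite expnM; apply: leq_pow; apply: leq_trans cQ; rewrite leq_sqr leq_pmull.
  have -> : 2 * k = k + k by rewrite mul2n addnn.
  rewrite (expnD p); apply: leq_mul => //; apply: leq_mul => //; apply: leq_mul => //.
  by rewrite addnn -mul2n.
apply: (@leq_trans (\sum_(w in nvset phi K setT | Iz (2 ^ J) w != set0) N (2 ^ J) w ^ 2)).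
  rewrite big_mkcond [X in _ <= X]big_mkcond /=; apply: leq_sum => w _.
  by case: (_ \in _) => //=; case: (_ <= k) => //=; case: ifP.
rewrite (partition_big (Izero phi K (2 ^ J)) (fun I => (I \in powerset K) && (I != set0))) /=; last first.
  by move=> g /andP[_ ->]; rewrite powersetE IzeroS.
apply: (@leq_trans (\sum_(I in powerset K) (k.+1 ^ k) ^ 2 * (C * p ^ (2 * k) * lg p ^ e))).
  rewrite big_mkcondr /=; apply: leq_sum => I; rewrite powersetE => IK.
  case: ifP => // I0; apply: leq_trans (sqrt_sum1 IK I0 (r := 2 ^ J) _ cQ); last by rewrite expn_gt0.
  by apply/eq_leq/eq_bigl => g; case: (eqVneq (Iz (2 ^ J) g) I) => [->|_]; rewrite ?andbF // I0 !andbT.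
rewrite sum_nat_const card_powerset -!mulnA leq_mul //.
  by rewrite leq_pexp2l // -wk (card_le_wt sys).
by rewrite !leq_mul // leq_pexp2l.
Qed.

End ScaleSums.

(** The integer dot product is divisible by [p] and smaller than [p] in absolute value, hence
    zero. *)
Lemma lft_row_orth (p d : nat) (p_pr : prime p) (u v : 'rV['F_p]_d) (a b : nat) :
  u \in box p d a -> v \in box p d b -> d * a * b <= p -> dotv u v = 0%R ->
  (lft_row u *m (lft_row v)^T = 0)%R.
Proof.
move=> ua vb dab uv0.
set z := (\sum_j lft (u ord0 j) * lft (v ord0 j))%R.
have z0 : z = 0%R.
  have pz : p %| `|z|%N by rewrite -intr_Fp_eq0 // /z dotv_lft // uv0.
  have lt_zp : `|z| < p.
    apply: leq_ltn_trans (absz_dot_le p_pr ua vb) _.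
    have p0 := prime_gt0 p_pr; case: a dab ua => [|a] dab ua; first by rewrite muln0 mul0n.
    case: d b u v ua vb uv0 z pz dab => [|d'] [|b] u v ua vb uv0 z pz dab; rewrite ?muln0 //.
    by apply: leq_trans dab; rewrite ltn_mul2r ltn_mul2l /= ltnSn.
  apply/eqP; rewrite -absz_eq0; case: (posnP `|z|%N) => [//|zgt].
  by have := dvdn_leq zgt pz; rewrite leqNgt lt_zp.
apply/matrixP => i j; rewrite !mxE.
rewrite -[RHS]/((0%R : int)%:~R)%R -z0 /z mulrz_sumr; apply: eq_bigr => l _.
by rewrite intrM !mxE.
Qed.

(** * Classes of large rank, handled through the dual system *)

Section DualSum.
Variable R : realType.
Variables (p s : nat) (F : 'I_s -> finFieldType) (kk : 'I_s -> nat).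
Variable tau : forall i, F i -> 'F_p.
Hypothesis sys : field_system kk tau.
Let p_pr : prime p. Proof. by case: sys. Qed.
Let cardF i : #|F i| = p ^ kk i. Proof. by case: sys. Qed.

Variables (d : nat) (phi : forall i, 'rV['F_p]_d -> F i * F i) (K : {set 'I_s}).
Hypothesis gK : good kk phi K.
Local Notation V := 'rV['F_p]_d.
Variables (k C e : nat).
Hypotheses (k0 : 0 < k) (wk : wt kk K = k) (kp : k < p).
Hypothesis IH : forall k', k' < k -> energy_bound k' C e.

Local Notation N q w := #|Gam phi K w :&: box p d q|.
Local Notation rk q w := (lft_rank (Gam phi K w :&: box p d q)).
Local Notation Iz q w := (Izero phi K q w).

(** Rank above [k] at [Q] leaves rank below [k] for the dual points of radius [2 * h]. So [N Q w] is
    first compared with the dual count at [2 * h], and that count is shrunk to radius [2 ^ J].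
    Injectivity of [T] then permits summing over the dual classes with [sqrt_sum]. *)
Lemma dual_sum (J Q h : nat) : (c0 k * 2 ^ J) ^ 2 <= p -> 0 < h <= p ->
  16 * (2 * k) * Q * h <= p -> 2 ^ J <= 2 * h ->
  (\sum_(w in nvset phi K setT | k < rk Q w) N Q w ^ 2) * (h * 2 ^ J) ^ (2 * k) <=
  (2 * (crank k * 2 ^ k) * p ^ k) ^ 2 * (csqrt k C * (p ^ (2 * k) * lg p ^ e.+1)).
Proof.
move=> cJ hp hQ Jh; have [phi' [T [g' TI phT orT]]] := dual_forms sys gK.
have dk := dim2k gK wk; set r := 2 ^ J in cJ Jh *.
have /andP[h0 _] := hp; have r0 : 0 < r by rewrite expn_gt0.
pose N' q w := #|Gam phi' K w :&: box p d q|.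
pose rk' q w := lft_rank (Gam phi' K w :&: box p d q).
have nvT w : nonvan phi' K (T w) = nonvan phi K w.
  by apply: eq_forallb => i; rewrite phT.
have key w : nonvan phi K w -> k < rk Q w ->
    (rk' r (T w) <= k) && (N Q w * (h * r) ^ k <= 2 * (crank k * 2 ^ k) * p ^ k * N' r (T w)).
  move=> nw rw; have rk2h : rk' (2 * h) (T w) <= k.
    have := @lft_rank_orth p d (Gam phi K w :&: box p d Q) (Gam phi' K (T w) :&: box p d (2 * h)).
    rewrite -/(rk' _ _) [X in _ <= X]dk => /(_ _) hh.
    suff : rk Q w + rk' (2 * h) (T w) <= 2 * k.
      by move: rw; move: (rk Q w) (rk' _ _) => x y; lia.
    apply: hh => u v /setIP[uG uQ] /setIP[vG vb].
    apply: (lft_row_orth p_pr uQ vb); first by rewrite dk; move: hQ; nia.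
    by move: vG; rewrite -orT // inE => /'forall_implyP/(_ u uG)/eqP.
  apply/andP; split.
    by apply: leq_trans rk2h; apply/lft_rankS/setIS/box_sub.
  have h1 : N Q w * h ^ (2 * k) <= 2 * p ^ k * N' (2 * h) (T w).
    have hQd : 16 * d * Q * h <= p by rewrite dk.
    have := dual_box_count R p_pr (@GamD _ _ _ _ _ _ _ gK K w) hp hQd.
    rewrite orT // (card_Gam_full sys gK wk nw).
    by have -> : h ^ d = h ^ (2 * k) by congr (_ ^ _).
  have h2 : N' (2 * h) (T w) * r ^ k <= crank k * (2 * h) ^ k * N' r (T w).
    exact: (N_rank_shrink sys g' k0 wk r0 Jh rk2h).
  rewrite -(leq_pmul2r (_ : 0 < h ^ k)); last by rewrite expn_gt0 h0.
  have e2 : h ^ (2 * k) = h ^ k * h ^ k by rewrite mul2n -addnn expnD.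
  move: h1 h2; rewrite e2 (expnMn 2 h) (expnMn h r); move: (N Q w) (N' _ _) (N' _ _) => x z y h1 h2.
  apply: (@leq_trans (2 * p ^ k * y * r ^ k)).
    apply: leq_trans (leq_mul h1 (leqnn (r ^ k))); apply: eq_leq; ring.
  rewrite -mulnA; apply: leq_trans (leq_mul (leqnn _) h2) _; apply: eq_leq; ring.
rewrite mulnC big_distrr /=.
have -> : (h * r) ^ (2 * k) = ((h * r) ^ k) ^ 2 by rewrite -expnM [k * 2]mulnC.
apply: (@leq_trans (\sum_(w in nvset phi K setT | k < rk Q w)
   (2 * (crank k * 2 ^ k) * p ^ k) ^ 2 * N' r (T w) ^ 2)).
  apply: leq_sum => w /andP[]; rewrite in_nvsetT => nw rw.
  by have /andP[_ h1] := key w nw rw; rewrite -!expnMn leq_sqr mulnC.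
rewrite -big_distrr leq_mul2l; apply/orP; right => /=.
apply: leq_trans (sqrt_sum sys g' k0 wk kp IH cJ).
set A := [set w : V | (w \in nvset phi K setT) && (k < rk Q w)].
rewrite (eq_bigl (fun w => w \in A)); last by move=> w; rewrite [RHS]in_set.
rewrite -(big_imset (fun w => N' r w ^ 2)) /=; last by move=> u v _ _; apply: TI.
rewrite big_mkcond [X in _ <= X]big_mkcond /=; apply: leq_sum => w _.
case: ifP => // /imsetP[u + ->]; rewrite inE in_nvsetT => /andP[nu ru].
by rewrite in_nvsetT nvT nu /=; have /andP[-> _] := key u nu ru.
Qed.

Definition cdual : nat :=
  4 * (crank k ^ 2 * 4 ^ k) * csqrt k C * (128 * k * c0 k) ^ (2 * k).

Lemma c0_gt0 j : 0 < c0 j. Proof. by []. Qed.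

Lemma sqrt_scale : c0 k ^ 2 <= p ->
  exists J, (c0 k * 2 ^ J) ^ 2 <= p /\ p < (2 * c0 k * 2 ^ J) ^ 2.
Proof.
move=> cp; pose P J := (c0 k * 2 ^ J) ^ 2 <= p.
have ex : exists J, P J by exists 0; rewrite /P muln1.
have bd J : P J -> J <= p.
  move=> PJ; apply: leq_trans (ltnW (ltn_expl J (isT : 1 < 2))) (leq_trans _ PJ).
  apply: (@leq_trans (c0 k * 2 ^ J)); first by rewrite leq_pmull.
  by rewrite -mulnn leq_pmulr // muln_gt0 c0_gt0 expn_gt0.
case: (ex_maxnP ex bd) => J PJ Jmax; exists J; split=> //.
rewrite ltnNge; apply/negP => h; have : P J.+1.
  by rewrite /P (expnS 2) mulnA [c0 k * 2]mulnC.
by move/Jmax; rewrite ltnn.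
Qed.

Lemma large_rank_sum (Q : nat) : 0 < Q -> (c0 k * Q) ^ 2 <= p ->
  \sum_(w in nvset phi K setT | k < rk Q w) N Q w ^ 2 <=
  cdual * (p ^ k * Q ^ (2 * k) * lg p ^ e.+1).
Proof.
move=> Q0 cQ.
have cp : c0 k ^ 2 <= p by apply: leq_trans cQ; rewrite leq_sqr leq_pmulr.
have [J [cJ pJ]] := sqrt_scale cp; set r := 2 ^ J in cJ pJ.
have r0 : 0 < r by rewrite expn_gt0.
pose D := 16 * (2 * k) * Q; have D0 : 0 < D by rewrite !muln_gt0 k0 Q0.
have c32 : 32 * k <= c0 k by rewrite /c0 leq_addl.
have cQr : (c0 k * Q) * (c0 k * r) <= p.
  by rewrite -leq_sqr expnMn -[p ^ 2]mulnn leq_mul.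
have Dr : r * D <= p.
  apply: leq_trans cQr; rewrite /D; have := c0_gt0 k; move: (c0 k) c32 => c c32 cgt.
  have : 32 * k * (Q * r) <= c * c * (Q * r).
    by rewrite leq_mul2r; apply/orP; right; nia.
  by move=> H; apply: leq_trans (leq_trans _ H) _; lia.
pose h := p %/ D.
have rh : r <= h by rewrite leq_divRL.
have h0 : 0 < h by apply: leq_trans rh.
have hp : 0 < h <= p by rewrite h0 leq_div.
have hQ : D * h <= p by rewrite mulnC leq_trunc_div.
(* [h] is the largest radius allowed by [dual_box_count]; rounding it down loses at most a factor
   2. *)
have pD : p <= 2 * D * h.
  apply: ltnW; apply: leq_trans (ltn_ceil p D0) _; rewrite -/h mulnAC leq_mul2r.
  by rewrite mul2n -addnn -addn1 leq_add2l h0 orbT.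
have Jh : 2 ^ J <= 2 * h by apply: leq_trans rh _; apply: leq_pmull.
have := dual_sum cJ hp hQ Jh; rewrite -/r; move: (\sum_(w in _ | _) _) => S hS.
(* Two factors [p ^ k] come from [p <= 64 * k * Q * h], the third from [p < (2 * c0 k * r) ^ 2];
   hence the constant [128 * k * c0 k]. *)
have p3 : p ^ (3 * k) <= (128 * k * c0 k) ^ (2 * k) * Q ^ (2 * k) * (h * r) ^ (2 * k).
  have e1 : p ^ (2 * k) <= (2 * D * h) ^ (2 * k) by apply: leq_pow.
  have e2 : p ^ k <= (2 * c0 k * r) ^ (2 * k) by rewrite expnM; apply/leq_pow/ltnW.
  have -> : 3 * k = 2 * k + k by lia.
  rewrite expnD; apply: leq_trans (leq_mul e1 e2) _.
  rewrite -!expnMn; apply: leq_pow; rewrite /D; apply: eq_leq; ring.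
rewrite -(leq_pmul2r (_ : 0 < (h * r) ^ (2 * k))); last by rewrite expn_gt0 muln_gt0 h0 r0.
apply: leq_trans hS _.
have -> : (2 * (crank k * 2 ^ k) * p ^ k) ^ 2 * (csqrt k C * (p ^ (2 * k) * lg p ^ e.+1)) =
   (4 * (crank k ^ 2 * 4 ^ k) * csqrt k C * p ^ k * lg p ^ e.+1) * p ^ (3 * k).
  have -> : 4 ^ k = (2 ^ k) ^ 2 by rewrite -expnM mulnC expnM.
  have -> : p ^ (3 * k) = p ^ k * p ^ (2 * k) by rewrite -expnD; congr (_ ^ _); lia.
  ring.
apply: leq_trans (leq_mul (leqnn _) p3) _.
by rewrite /cdual; apply: eq_leq; ring.
Qed.

End DualSum.

(** * The induction on the total degree *)

Section EnergyStep.
Variable R : realType.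
Variables (p s : nat) (F : 'I_s -> finFieldType) (kk : 'I_s -> nat).
Variable tau : forall i, F i -> 'F_p.
Hypothesis sys : field_system kk tau.
Let p_pr : prime p. Proof. by case: sys. Qed.
Let cardF i : #|F i| = p ^ kk i. Proof. by case: sys. Qed.

Variables (d : nat) (phi : forall i, 'rV['F_p]_d -> F i * F i) (K : {set 'I_s}).
Hypothesis gK : good kk phi K.
Local Notation V := 'rV['F_p]_d.
Variables (k C e : nat).
Hypotheses (k0 : 0 < k) (wk : wt kk K = k).
Hypothesis IH : forall k', k' < k -> energy_bound k' C e.

Local Notation N q w := #|Gam phi K w :&: box p d q|.
Local Notation rk q w := (lft_rank (Gam phi K w :&: box p d q)).
Local Notation Iz q w := (Izero phi K q w).

Definition cstep : nat :=
  (4 * c0 k) ^ (4 * k) + ((8 * c0 k) ^ (2 * k) * cmix k C +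
  k.+1 ^ k * ((8 * c0 k) ^ (2 * k)) ^ 2 * (cscale k C + cdual k C)).

Lemma energy_step_sys (a : V) (m : nat) : 0 < m -> m ^ 2 <= 4 * p ->
  energy phi K (tbox a m) <= cstep * m ^ (2 * k) * lg p ^ e.+1.
Proof.
move=> m0 mp; have dk := dim2k gK wk; have l0 : 0 < lg p by [].
have m2k : 0 < m ^ (2 * k) by rewrite expn_gt0 m0.
have cc := c0_gt0 k.
(* Bounded [m] is absorbed in the constant; otherwise [c0 k ^ 2 <= p], which also yields [k < p]. *)
case: (ltnP m (2 * c0 k)) => [small|large].
  apply: (@leq_trans ((4 * c0 k) ^ (4 * k))); last first.
    rewrite /cstep -mulnA mulnDl; apply: leq_trans (leq_addr _ _).
    by rewrite leq_pmulr // muln_gt0 m2k expn_gt0.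
  apply: leq_trans (relpairs_card _ _ _) _.
  have cX : #|nvset phi K (tbox a m)| <= (4 * c0 k) ^ (2 * k).
    apply: (@leq_trans #|tbox a m|).
      by apply/subset_leq_card/subsetP => w; rewrite inE => /andP[].
    apply: leq_trans (card_tbox_le p_pr a m) _.
    have -> : (2 * m) ^ d = (2 * m) ^ (2 * k) by congr (_ ^ _).
    by apply: leq_pow; lia.
  apply: leq_trans (leq_mul cX cX) _; rewrite -expnD.
  by have -> : 2 * k + 2 * k = 4 * k by lia.
have cp : c0 k ^ 2 <= p.
  by rewrite -(leq_pmul2l (isT : 0 < 4)) (leq_trans _ mp) // -[4]/(2 ^ 2) -expnMn leq_sqr.
have kp' : k < p.
  by apply: leq_trans cp; rewrite -mulnn /c0; nia.
pose x := m %/ (2 * c0 k).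
have x0 : 0 < x by rewrite divn_gt0 // muln_gt0.
pose J := trunc_log 2 x; have := trunc_log_bounds x0; rewrite -/J.
set Q := 2 ^ J => /andP[Qx xQ].
have Q0 : 0 < Q by rewrite expn_gt0.
have Qm : 2 * c0 k * Q <= m.
  by apply: leq_trans (leq_trunc_div m (2 * c0 k)); rewrite -/x mulnC leq_mul2r Qx orbT.
have mQ : m <= 4 * c0 k * Q.
  apply: ltnW; apply: leq_trans (ltn_ceil m (_ : 0 < 2 * c0 k)) _; first by rewrite muln_gt0.
  by rewrite -/x; apply: leq_trans (leq_mul xQ (leqnn _)) _; apply: eq_leq; ring.
have cQ : (c0 k * Q) ^ 2 <= p.
  rewrite -(leq_pmul2l (isT : 0 < 4)) (leq_trans _ mp) // -[4]/(2 ^ 2) -expnMn leq_sqr.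
  by rewrite mulnA.
have cQm : c0 k * Q <= m by apply: leq_trans Qm; rewrite -mulnA leq_pmull.
set X := nvset phi K (tbox a m).
(* A class meets the translated box in at most a constant times its count in the centred box of
   radius [Q], since differences stay in the subgroup [Gam K w]. *)
have rb w : \sum_(v in X) par phi K v w <= (8 * c0 k) ^ (2 * k) * N Q w.
  rewrite sum_bool_card.
  have -> : (8 * c0 k) ^ (2 * k) = (2 * (4 * c0 k)) ^ d.
    by rewrite mulnA; congr (_ ^ _); rewrite dk.
  apply: (cover_card p_pr (a := a) Q0 mQ).
    by apply/subsetP => v; rewrite inE => /andP[+ _]; rewrite inE => /andP[].
  move=> u v; rewrite inE [v \in _]inE => /andP[_ uw] /andP[_ vw] hb.
  by rewrite inE hb andbT; apply: (GamB gK); rewrite inE.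
have rb' w : \sum_(v in X) par phi K w v <= (8 * c0 k) ^ (2 * k) * N Q w.
  by apply: leq_trans (rb w); apply: leq_sum => v _; rewrite par_sym.
rewrite /energy -/X /relpairs (bigID (fun g => Iz Q g != set0)) /=.
have part1 : \sum_(g in X | Iz Q g != set0) \sum_(v in X) par phi K g v <=
    (8 * c0 k) ^ (2 * k) * cmix k C * (m ^ (2 * k) * lg p ^ e.+1).
  apply: (@leq_trans ((8 * c0 k) ^ (2 * k) * (cmix k C * m ^ (2 * k) * lg p ^ e))).
    apply: leq_trans (leq_mul (leqnn _) (mixed_sum sys gK wk kp' IH a cQm m0 mp)).
    by rewrite big_distrr /=; apply: leq_sum => g _; apply: rb'.
  by rewrite -!mulnA !leq_mul // leq_pexp2l.
have part2 : \sum_(g in X | ~~ (Iz Q g != set0)) \sum_(v in X) par phi K g v <=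
    k.+1 ^ k * ((8 * c0 k) ^ (2 * k)) ^ 2 * (cscale k C + cdual k C) * (m ^ (2 * k) * lg p ^ e.+1).
  (* The factor [p ^ k] spreads each pair over the nonvanishing [w] of its class: [proportion] at
     radius [p], where the box is everything, supplies at least [p ^ k] divided by [k.+1 ^ k] of
     them. This turns the pair count into a second moment over [w]. *)
  have p0 : 0 < p ^ k by rewrite expn_gt0 prime_gt0.
  rewrite -(leq_pmul2l p0).
  set W := nvset phi K setT.
  apply: (@leq_trans (k.+1 ^ k * \sum_(w in W | Iz Q w == set0)
     ((8 * c0 k) ^ (2 * k) * N Q w) ^ 2)).
    apply: (@leq_trans (k.+1 ^ k * \sum_(g in X | ~~ (Iz Q g != set0)) \sum_(v in X)
       \sum_(w in W | Iz Q w == set0) par phi K w g * par phi K w v)).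
      rewrite !big_distrr /=; apply: leq_sum => g /andP[gX /negPn gI].
      have ng : nonvan phi K g by move: gX; rewrite inE => /andP[].
      rewrite !big_distrr /=; apply: leq_sum => v vX.
      case: (boolP (par phi K g v)) => [gv|_]; last by rewrite muln0.
      rewrite muln1 -(card_Gam_full sys gK wk ng).
      have := proportion sys gK p g wk kp'; rewrite (box_full p_pr d (leqnn p)) setIT.
      move/leq_trans; apply; rewrite leq_mul2l; apply/orP; right.
      have -> : Iz p g = set0.
        apply/eqP; rewrite -subset0; apply/subsetP => i; rewrite inE => /andP[iK /'forall_implyP/(_ g)].
        rewrite (box_full p_pr d (leqnn p)) setIT inE par_refl => /(_ isT) g0.
        by move/nonvanP: ng => /(_ i iK); rewrite g0.
      rewrite setD0 -sum1_card big_mkcond [X in _ <= X]big_mkcond /=; apply: leq_sum => w _.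
      case: ifP => //; rewrite inE => /andP[/setIP[wG _] /andP[_ nw]].
      have wg : par phi K w g by move: wG; rewrite inE.
      have eG := par_Gam_eq nw ng wg.
      by rewrite in_nvsetT nw (Izero_eq Q eG) gI /= wg (par_trans ng wg gv).
    rewrite leq_mul2l; apply/orP; right.
    under eq_bigr do rewrite exchange_big /=.
    rewrite exchange_big /=; apply: leq_sum => w _.
    under eq_bigr do rewrite -big_distrr /=.
    rewrite -big_distrl /= -mulnn; apply: leq_mul; last exact: rb'.
    apply: leq_trans (rb' w); rewrite big_mkcondr /=; apply: leq_sum => g _; by case: ifP.
  under eq_bigr do rewrite expnMn.
  rewrite -big_distrr /= (bigID (fun w => rk Q w <= k)) /=.
  set S1 := (X in _ * (_ * (X + _))); set S2 := (X in _ * (_ * (_ + X))).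
  have hS1 : S1 <= cscale k C * (p ^ k * Q ^ (2 * k) * lg p ^ e.+1).
    apply: leq_trans (scale_sum sys gK k0 wk kp' IH cQ); apply/eq_leq/eq_bigl => w.
    by rewrite -andbA.
  have hS2 : S2 <= cdual k C * (p ^ k * Q ^ (2 * k) * lg p ^ e.+1).
    apply: leq_trans (large_rank_sum R sys gK k0 wk kp' IH Q0 cQ); rewrite /S2.
    rewrite big_mkcond [X in _ <= X]big_mkcond /=.
    apply: leq_sum => w _; rewrite -ltnNge; case: (w \in W) => //=.
    by case: (_ == _) => //=; case: ifP.
  have QM : Q ^ (2 * k) <= m ^ (2 * k).
    by apply: leq_pow; apply: leq_trans cQm; rewrite leq_pmull.
  move: S1 S2 hS1 hS2 => S1 S2 hS1 hS2.
  apply: (@leq_trans (k.+1 ^ k * (((8 * c0 k) ^ (2 * k)) ^ 2 *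
    ((cscale k C + cdual k C) * (p ^ k * m ^ (2 * k) * lg p ^ e.+1))))); last first.
    by apply: eq_leq; ring.
  rewrite !leq_mul2l; apply/orP; right; apply/orP; right.
  rewrite mulnDl; apply: leq_add; [apply: leq_trans hS1 _|apply: leq_trans hS2 _].
    by rewrite !leq_mul.
  by rewrite !leq_mul.
apply: leq_trans (leq_add part1 part2) _; rewrite -mulnDl -[X in _ <= X]mulnA leq_mul2r /cstep.
by rewrite leq_addl orbT.
Qed.

End EnergyStep.

Lemma energy_bound_mono (k C C' e e' : nat) : C <= C' -> e <= e' ->
  energy_bound k C e -> energy_bound k C' e'.
Proof.
move=> CC ee h p s F kk tau sys K d phi a m g w m0 mp.
apply: leq_trans (h _ _ _ _ _ sys K d phi a m g w m0 mp) _.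
by rewrite !leq_mul // leq_pexp2l.
Qed.

Lemma energy_bound0 : energy_bound 0 1 0.
Proof.
move=> p s F kk tau sys K d phi a m g w m0 mp.
apply: leq_trans (relpairs_card _ _ _) _; have -> : 1 * m ^ (2 * 0) * lg p ^ 0 = 1 by rewrite muln0.
have d0 : d = 0 by rewrite (dimE g) w.
have c1 (X : {set 'rV['F_p]_d}) : #|X| <= 1.
  apply: leq_trans (max_card _) _; rewrite card_mx mul1n.
  by have -> : #|'F_p| ^ d = #|'F_p| ^ 0 by congr (_ ^ _).
exact: leq_mul (c1 _) (c1 _).
Qed.

Lemma energy_bound_uniform (n : nat) : (forall k, k < n -> exists C e, energy_bound k C e) ->
  exists C e, forall k, k < n -> energy_bound k C e.
Proof.
elim: n => [|n IHn] h; first by exists 0, 0.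
have [|C [e hn]] := IHn; first by move=> k kn; apply: h; apply: ltnW.
have [C' [e' h']] := h n (ltnSn n).
exists (maxn C C'), (maxn e e') => k; rewrite ltnS leq_eqVlt => /orP[/eqP->|kn].
  exact: energy_bound_mono (leq_maxr _ _) (leq_maxr _ _) h'.
exact: energy_bound_mono (leq_maxl _ _) (leq_maxl _ _) (hn k kn).
Qed.

Theorem energy_boundP (R : realType) (k : nat) : exists C e, energy_bound k C e.
Proof.
have [n] := ubnP k; elim: n k => // n IHn k /ltnSE kn.
case: (posnP k) => [->|k0]; first by exists 1, 0; apply: energy_bound0.
have [|C [e h]] := @energy_bound_uniform k.
  by move=> j jk; apply: IHn; apply: leq_trans kn.
exists (cstep k C), e.+1 => p s F kk tau sys K d phi a m g w m0 mp.
exact: (energy_step_sys R sys g k0 w h).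
Qed.

(** * Removing the nonvanishing condition *)

Section ZeroSets.
Variables (p s : nat) (F : 'I_s -> finFieldType) (kk : 'I_s -> nat).
Variable tau : forall i, F i -> 'F_p.
Hypothesis sys : field_system kk tau.
Variables (d : nat) (phi : forall i, 'rV['F_p]_d -> F i * F i).
Hypothesis gT : good kk phi setT.
Local Notation V := 'rV['F_p]_d.
Variables (k C e : nat).
Hypothesis wk : wt kk setT = k.
Hypothesis EB : forall k', k' < k.+1 -> energy_bound k' C e.

Lemma wt_sym_diff (I J : {set 'I_s}) :
  wt kk (J :\: I) + wt kk (I :\: J) + wt kk (~: (I :|: J)) <= k.
Proof.
have mk (A : {set 'I_s}) : wt kk A = \sum_i (if i \in A then kk i else 0) by apply: big_mkcond.
rewrite -wk !mk -!big_split /=; apply: leq_sum => i _; rewrite !inE.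
by case: (i \in I); case: (i \in J); rewrite ?addn0.
Qed.

(** Only blocks outside both zero sets impose a condition. After Cauchy-Schwarz the two energies
    lose the weights of [J :\: I] and [I :\: J]; with the weight of [K'] these total at most [k], so
    the exponent stays within [2 * k]. *)
Lemma zero_sets_pairs (I J : {set 'I_s}) (a : V) (m : nat) (K' := ~: (I :|: J)) :
  0 < m -> m ^ 2 <= 4 * p ->
  relpairs (par phi K') (nvset phi K' (vanish phi I :&: tbox a m))
    (nvset phi K' (vanish phi J :&: tbox a m)) <= 4 ^ k * (C * m ^ (2 * k) * lg p ^ e).
Proof.
move=> m0 mp; have := wt_sym_diff I J; rewrite -/K' => wle.
have EK : energy_bound (wt kk K') C e.
  by apply: EB; rewrite ltnS; apply: leq_trans wle; rewrite leq_addl.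
have sI : K' \subset setT :\: I by rewrite setTD setCS subsetUl.
have sJ : K' \subset setT :\: J by rewrite setTD setCS subsetUr.
have eI : setT :\: I :\: K' = J :\: I.
  by apply/setP => i; rewrite !inE; case: (i \in I); case: (i \in J).
have eJ : setT :\: J :\: K' = I :\: J.
  by apply/setP => i; rewrite !inE; case: (i \in I); case: (i \in J).
have := sub_energy sys gT a (subsetT I) sI EK m0 mp; rewrite eI => E1.
have := sub_energy sys gT a (subsetT J) sJ EK m0 mp; rewrite eJ => E2.
rewrite -leq_sqr; apply: leq_trans (energy_CS _ _ _ _) (leq_trans (leq_mul E1 E2) _).
move: wle; set x := wt kk (J :\: I); set x' := wt kk (I :\: J); set y := wt kk K' => wle.
have -> : (2 * m) ^ (4 * x) * (C * m ^ (2 * y) * lg p ^ e) *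
    ((2 * m) ^ (4 * x') * (C * m ^ (2 * y) * lg p ^ e)) =
    (4 ^ (x + x') * (C * m ^ (2 * (x + x' + y)) * lg p ^ e)) ^ 2.
  have e4 t : (2 * m) ^ (4 * t) = (4 ^ t * m ^ (2 * t)) ^ 2.
    have -> : 4 * t = 2 * t * 2 by lia.
    by rewrite expnM; congr (_ ^ 2); rewrite expnM (expnMn 2 m 2) (expnMn (2 ^ 2)) -(expnM m).
  by rewrite !e4 !mulnDr !expnD; ring.
rewrite leq_sqr !leq_mul // leq_pexp2l //; first by apply: leq_trans wle; apply: leq_addr.
by rewrite leq_mul2l wle orbT.
Qed.

Lemma box_pairs (a : V) (m : nat) : 0 < m -> m ^ 2 <= 4 * p ->
  relpairs (par phi setT) (tbox a m) (tbox a m) <=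
  4 ^ k * (4 ^ k * (C * m ^ (2 * k) * lg p ^ e)).
Proof.
move=> m0 mp; set X := tbox a m.
pose Z (g : V) : {set 'I_s} := [set i | phi i g == 0%R].
pose bnd := 4 ^ k * (C * m ^ (2 * k) * lg p ^ e).
have -> : relpairs (par phi setT) X X = \sum_(I : {set 'I_s}) \sum_(J : {set 'I_s})
   \sum_(g in X | Z g == I) \sum_(h in X | Z h == J) par phi setT g h.
  rewrite /relpairs (partition_big Z predT) //=; apply: eq_bigr => I _.
  rewrite [RHS]exchange_big /=; apply: eq_bigr => g _.
  by rewrite (partition_big Z predT).
apply: (@leq_trans (\sum_(I : {set 'I_s}) \sum_(J : {set 'I_s}) bnd)).
  apply: leq_sum => I _; apply: leq_sum => J _.
  apply: leq_trans (zero_sets_pairs I J a m0 mp); rewrite /relpairs -/X.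
  set K' := ~: (I :|: J).
  have memI (g : V) : (g \in X) && (Z g == I) -> g \in nvset phi K' (vanish phi I :&: X).
    move=> /andP[gX /eqP gI]; rewrite inE inE gX andbT; apply/andP; split.
      by apply/vanishP => i; rewrite -gI inE => /eqP.
    by apply/nonvanP => i; rewrite !inE -gI inE negb_or => /andP[].
  have memJ (g : V) : (g \in X) && (Z g == J) -> g \in nvset phi K' (vanish phi J :&: X).
    move=> /andP[gX /eqP gI]; rewrite inE inE gX andbT; apply/andP; split.
      by apply/vanishP => i; rewrite -gI inE => /eqP.
    by apply/nonvanP => i; rewrite !inE -gI inE negb_or => /andP[].
  rewrite big_mkcond [X in _ <= X]big_mkcond /=; apply: leq_sum => g _.
  case: ifP => // /memI ->; rewrite big_mkcond [X in _ <= X]big_mkcond /=.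
  apply: leq_sum => h _; case: ifP => // /memJ ->.
  case: (boolP (par phi setT g h)) => // gh; rewrite (par_subset _ gh) //; exact: subsetT.
rewrite !sum_nat_const mulnA leq_mul2r; apply/orP; right.
have -> : #|{set 'I_s}| = 2 ^ s by rewrite -cardsT -powersetT card_powerset cardsT card_ord.
rewrite -expnMn; apply: leq_pexp2l => //; rewrite -wk.
by have := card_le_wt sys setT; rewrite cardsT card_ord.
Qed.

End ZeroSets.

(** * The power basis and a linear functional on each field *)

Section Embedding.
Variables (p m : nat) (F : finFieldType) (w : F).
Hypotheses (p_pr : prime p) (cF : #|F| = p ^ m) (pb : powbasis p m w).

Definition pow_embed (c : 'rV['F_p]_m) : F := (\sum_(j < m) Fp_to F (c 0 j) * w ^+ j)%R.

Lemma Fp_toB (a b : 'F_p) : Fp_to F (a - b)%R = (Fp_to F a - Fp_to F b)%R.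
Proof.
have chp := card_finPcharP cF p_pr.
suff D (x y : 'F_p) : Fp_to F (x + y)%R = (Fp_to F x + Fp_to F y)%R.
  by apply/eqP; rewrite eq_sym subr_eq -D subrK.
rewrite /Fp_to -natrD -(GRing.natr_mod_pchar chp (val x + val y)); congr (_%:R)%R.
by rewrite /=; congr (_ %% _); rewrite Fp_cast.
Qed.

Lemma pow_embedB (c c' : 'rV['F_p]_m) :
  pow_embed (c - c')%R = (pow_embed c - pow_embed c')%R.
Proof.
by rewrite /pow_embed -sumrB; apply: eq_bigr => j _; rewrite !mxE Fp_toB mulrBl.
Qed.

Lemma pow_embed_inj : injective pow_embed.
Proof. exact: bij_inj pb. Qed.

Lemma pow_embed_onto x : exists c, pow_embed c = x.
Proof. by case: pb => g _ gK; exists (g x); apply: gK. Qed.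

Variable j0 : 'I_m.

(** Since the power basis represents every element, the default 0 is never taken. One coordinate
    functional replaces the trace. *)
Definition pow_coord (x : F) : 'F_p :=
  if [pick c : 'rV['F_p]_m | pow_embed c == x] is Some c then c 0%R j0 else 0%R.

Lemma pow_coordE c : pow_coord (pow_embed c) = c 0%R j0.
Proof.
rewrite /pow_coord; case: pickP => [c' /eqP/pow_embed_inj -> //|/(_ c)].
by rewrite eqxx.
Qed.

Lemma pow_coordB x y : pow_coord (x - y)%R = (pow_coord x - pow_coord y)%R.
Proof.
have [c <-] := pow_embed_onto x; have [c' <-] := pow_embed_onto y.
by rewrite -pow_embedB !pow_coordE !mxE.
Qed.

Lemma pow_coord_neq0 : exists x, pow_coord x != 0%R.
Proof.
exists (pow_embed (delta_mx 0 j0)%R); rewrite pow_coordE mxE !eqxx; exact: oner_neq0.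
Qed.

End Embedding.

(** * From the given linear forms to a square system *)

Section Extension.
Variables (p n s : nat) (kk : 'I_s -> nat) (F : 'I_s -> finFieldType) (w : forall i, F i).
Variable L : forall i, 'M['F_p]_(kk i, n).
Hypotheses (p_pr : prime p) (kk0 : forall i, 0 < kk i).
Hypotheses (cF : forall i, #|F i| = p ^ kk i) (pb : forall i, powbasis p (kk i) (w i)).
Hypothesis rkL : \rank (\mxcol_(i < s) L i)%R = n.

Local Notation A := ((\mxcol_(i < s) L i)^T)%R.
Local Notation B := (row_base A^C%MS).
Local Notation r := (\rank A^C%MS).

(* The k - n extra columns complete the coefficient matrix to an invertible one. *)
Definition ext_lam i (u : 'rV['F_p]_(n + r)) : F i :=
  pow_embed (w i) (submxrow (u *m col_mx A B)%R i).

Definition ext_phi i (g : 'rV['F_p]_((n + r) + (n + r))) : F i * F i :=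
  (ext_lam i (lsubmx g), ext_lam i (rsubmx g)).

Lemma ext_lamB i u v : ext_lam i (u - v)%R = (ext_lam i u - ext_lam i v)%R.
Proof. by rewrite /ext_lam mulmxBl submxrowB (pow_embedB (w i) p_pr (cF i)). Qed.

Lemma ext_dim : n + r = \sum_i kk i.
Proof. by rewrite mxrank_compl mxrank_tr rkL subnKC // -rkL rank_leq_row. Qed.

Lemma ext_lam_inj u : (forall i, ext_lam i u = 0%R) -> u = 0%R.
Proof.
move=> h; have fM : row_free (col_mx A B).
  rewrite /row_free -addsmxE (adds_eqmx (eqmx_refl A) (eq_row_base A^C%MS)).
  by have := addsmx_compl_full A; rewrite /row_full => /eqP ->; rewrite ext_dim.
apply: (row_free_inj fM); rewrite mul0mx; apply/mxrowP => i; rewrite submxrow0.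
apply: (pow_embed_inj (pb i)); rewrite -/(ext_lam i u) h.
by have := pow_embedB (w i) p_pr (cF i) 0%R 0%R; rewrite !subrr => ->.
Qed.

Lemma ext_good : good kk ext_phi setT.
Proof.
split=> [i u v|g h|].
- by rewrite /ext_phi !raddfB /= !ext_lamB.
- rewrite -[g]hsubmxK; rewrite (ext_lam_inj (u := lsubmx g)); last first.
    by move=> i; have [] := h i (in_setT i).
  rewrite (ext_lam_inj (u := rsubmx g)) ?row_mx0 // => i.
  by have [] := h i (in_setT i).
- by rewrite ext_dim /wt addnn -mul2n; congr (2 * _); apply: eq_bigl => i; rewrite inE.
Qed.

Lemma ext_system : exists tau : forall i, F i -> 'F_p, field_system kk tau.
Proof.
exists (fun i => pow_coord p (w i) (Ordinal (kk0 i))); split=> // i.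
  exact: (pow_coordB p_pr (cF i) (pb i)).
exact: pow_coord_neq0 (pb i) _.
Qed.

Definition red_row (x : 'I_n -> int) : 'rV['F_p]_(n + r) := row_mx (\row_l (x l)%:~R)%R 0%R.

Lemma lam_ext i x : lam (w i) (L i) x = ext_lam i (red_row x).
Proof.
rewrite /ext_lam /red_row mul_row_col mul0mx addr0 -mul_submxrow tr_mxcol mxrowK.
apply: eq_bigr => j _; congr (Fp_to _ _ * _)%R; rewrite !mxE.
by apply: eq_bigr => l _; rewrite !mxE mulrC.
Qed.

Variables (H : nat) (N : 'I_n -> int) (Hs : 'I_n -> nat).
Hypotheses (H0 : 0 < H) (Hp : H ^ 2 <= p) (HH : forall l, H <= Hs l <= 2 * H).

(** Sides at most [p] keep distinct integer points distinct modulo [p]. For [H >= 2] this is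
    [2 * H <= H ^ 2]; for [H = 1] it is [2 <= p]. *)
Lemma bmax_le : bmax Hs <= p.
Proof.
apply: (@leq_trans (2 * H)); first by apply/bigmax_leqP => l _; case/andP: (HH l).
have := prime_gt1 p_pr; move: Hp H0; rewrite -mulnn; move: H => [|[|h]]; nia.
Qed.

Lemma red_row_inj : injective (fun t => red_row (boxpt N (Hs := Hs) t)).
Proof.
move=> t t' /eq_row_mx[/rowP h _]; apply/ffunP => l; apply: val_inj.
have := h l; rewrite !mxE /boxpt !mulrzDr => /addIr/addrI /eqP.
rewrite -subr_eq0 -mulrzBr intr_Fp_eq0 // => /dvdnP[c hc].
have := leq_trans (ltn_ord (t l)) bmax_le; have := leq_trans (ltn_ord (t' l)) bmax_le.
move: hc; rewrite /=; move: (nat_of_ord (t l)) (nat_of_ord (t' l)) => x y.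
case: c => [|c]; first by rewrite mul0n; lia.
nia.
Qed.

(** A point with offset [t < 2 * H] differs from this centre by [t - H], hence the strict radius
    [H + 1]. The added coordinates are zero and cost nothing. *)
Definition box_center : 'rV['F_p]_(n + r) := red_row (fun l => (N l + H%:R + 1)%R).

Lemma red_row_box t : inbox (Hs := Hs) t -> red_row (boxpt N t) \in tbox box_center H.+1.
Proof.
move=> /forallP ht; rewrite inE; apply/boxP => j; rewrite !mxE.
case: splitP => l _; rewrite !mxE; last by rewrite subrr (nrm0 p_pr).
have h : ((val (t l))%:Z - H%:Z)%R%:~R%R = ((boxpt N t l)%:~R - (N l + H%:R + 1)%:~R)%R :> 'F_p.
  by rewrite -mulrzBr; congr (_%:~R)%R; rewrite /boxpt natz; ring.
rewrite ltnS; apply: leq_trans (nrm_le p_pr h) _.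
have := ht l; have /andP[_] := HH l; rewrite /=; move: (nat_of_ord (t l)) => x; lia.
Qed.

(** A quadruple becomes the pair of vectors (x, x') and (y, y'); the equation in [F i] is the
    vanishing of their determinant. *)
Lemma Enk_le_pairs (X := tbox (row_mx box_center box_center) H.+1) :
  Enk w L N Hs <= relpairs (par ext_phi setT) X X.
Proof.
pose pt t := red_row (boxpt N (Hs := Hs) t).
pose f (q : {ffun 'I_n -> 'I_(bmax Hs)} * {ffun 'I_n -> 'I_(bmax Hs)}
             * {ffun 'I_n -> 'I_(bmax Hs)} * {ffun 'I_n -> 'I_(bmax Hs)}) :=
  let: (tx, tx', ty, ty') := q in (row_mx (pt tx) (pt tx'), row_mx (pt ty) (pt ty')).
have fI : injective f.
  move=> [[[a b] c] d] [[[a' b'] c'] d'] [] /eq_row_mx[ha hb] /eq_row_mx[hc hd].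
  by rewrite (red_row_inj ha) (red_row_inj hb) (red_row_inj hc) (red_row_inj hd).
have memX t t' : inbox t -> inbox t' -> row_mx (pt t) (pt t') \in X.
  move=> /red_row_box ht /red_row_box ht'; rewrite inE; apply/boxP => j.
  rewrite opp_row_mx add_row_mx mxE; move: ht ht'; rewrite !inE => /forallP h /forallP h'.
  by case: splitP => l _; [apply: h|apply: h'].
have -> : relpairs (par ext_phi setT) X X =
    #|[set g : 'rV['F_p]_((n + r) + (n + r)) * 'rV['F_p]_((n + r) + (n + r)) |
       [&& g.1 \in X, g.2 \in X & par ext_phi setT g.1 g.2]]|.
  rewrite /relpairs pair_big_dep /= -sum1_card [RHS]big_mkcond [LHS]big_mkcond /=.
  apply: eq_bigr => [[g h]] _; rewrite [in RHS]in_set /=.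
  by case: (g \in X) => //=; case: (h \in X) => //=; case: (par _ _ _ _).
rewrite /Enk -(card_imset _ fI); apply: subset_leq_card; apply/subsetP => _ /imsetP[q + ->].
case: q => [[[tx tx'] ty] ty']; rewrite inE => /and5P[h1 h2 h3 h4 /forallP h].
rewrite inE /= !memX //=; apply/parP => i _; apply/eqP; have := h i.
by rewrite !lam_ext /symp /ext_phi /= !row_mxKl !row_mxKr subr_eq0.
Qed.

End Extension.

(** Bernoulli's inequality for [y = 2 ^ (eps / (e + 1))] bounds [lg p] by a multiple of [y ^ j],
    with [2 ^ j <= p]. The exponent [e + 1] instead of [e] avoids dividing by zero. *)
Lemma polylog_bound (R : realType) (e : nat) (eps : R) : (0 < eps)%R ->
  exists C : R, (0 <= C)%R /\ forall p, prime p -> (((lg p) ^ e)%:R <= C * p%:R `^ eps)%R.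
Proof.
move=> eps0; pose y : R := (2 `^ (eps / e.+1%:R))%R.
have y1 : (1 < y)%R.
  have : (1 `^ (eps / e.+1%:R) < y)%R.
    by apply: gt0_ltr_powR; rewrite ?nnegrE ?ltr1n // divr_gt0.
  by rewrite powR1.
pose dl := (y - 1)%R; have dl0 : (0 < dl)%R by rewrite subr_gt0.
have bern j : (1 + j%:R * dl <= y ^+ j)%R.
  elim: j => [|j IHj]; first by rewrite mul0r addr0.
  rewrite exprSr; apply: le_trans (ler_wpM2r _ IHj); last by rewrite ltW // (lt_trans ltr01).
  have -> : y = (1 + dl)%R by rewrite /dl; ring.
  rewrite -natr1; have : (0 <= j%:R * (dl * dl))%R by rewrite mulr_ge0 // ?ler0n // mulr_ge0 // ltW.
  lra.
exists ((1 + dl^-1) ^+ e.+1)%R; split.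
  by rewrite exprn_ge0 // addr_ge0 // invr_ge0 ltW.
move=> p p_pr; set j := trunc_log 2 p.
have pj : (2 ^ j <= p)%N by rewrite trunc_logP // prime_gt0.
have h1 : ((lg p)%:R <= (1 + dl^-1) * y ^+ j)%R.
  apply: le_trans (ler_wpM2l _ (bern j)); last by rewrite addr_ge0 // invr_ge0 ltW.
  have -> : ((1 + dl^-1) * (1 + j%:R * dl) = j%:R + 1 + dl^-1 + j%:R * dl)%R by field; rewrite gt_eqF.
  rewrite /lg -natr1 -/j -addrA lerDl addr_ge0 ?invr_ge0 ?(ltW dl0) //.
  by rewrite mulr_ge0 // ltW.
have h2 : ((lg p)%:R ^+ e <= (lg p)%:R ^+ e.+1 :> R)%R.
  by apply: ler_weXn2l; rewrite // ler1n.
rewrite natrX; apply: le_trans h2 _.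
apply: (@le_trans _ _ (((1 + dl^-1) * y ^+ j) ^+ e.+1)%R).
  by rewrite ler_pXn2r // nnegrE ?ler0n // mulr_ge0 ?exprn_ge0 ?addr_ge0 ?invr_ge0 ?ltW // (lt_trans ltr01).
rewrite exprMn ler_wpM2l ?exprn_ge0 ?addr_ge0 ?invr_ge0 ?(ltW dl0) //.
have -> : ((y ^+ j) ^+ e.+1 = (2 ^ j)%:R `^ eps)%R.
  rewrite exprAC -[(y ^+ e.+1)%R]powR_mulrn ?powR_ge0 // /y -powRrM divfK ?pnatr_eq0 //.
  rewrite -powR_mulrn ?powR_ge0 // -powRrM mulrC powRrM powR_mulrn ?ler0n //.
  by rewrite natrX.
by apply: ge0_ler_powR; rewrite ?nnegrE ?ler0n ?(ltW eps0) // ler_nat.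
Qed.

Local Open Scope ring_scope.

Theorem theorem1p7 (R : realType) (k : nat) (eps : R) (heps : 0 < eps) :
  exists C : R, forall (p n s : nat) (kk : 'I_s -> nat)
    (F : 'I_s -> finFieldType) (w : forall i, F i)
    (L : forall i, 'M['F_p]_(kk i, n))
    (H : nat) (N : 'I_n -> int) (Hs : 'I_n -> nat),
    prime p -> (1 <= n)%N -> (n <= k)%N ->
    (forall i, 0 < kk i)%N -> (\sum_(i < s) kk i)%N = k ->
    (forall i, #|F i| = (p ^ kk i)%N) ->
    (forall i, powbasis p (kk i) (w i)) ->
    \rank (\mxcol_(i < s) L i) = n ->
    (1 <= H)%N -> (H ^ 2 <= p)%N ->
    (forall l, H <= Hs l <= 2 * H)%N ->
    (Enk w L N Hs)%:R <= C * (H%:R) ^+ (2 * k) * (p%:R) `^ eps.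
Proof.
have [C1 [e EB]] : exists C e, forall k', (k' < k.+1)%N -> energy_bound k' C e.
  by apply: energy_bound_uniform => k' _; apply: (energy_boundP R).
have [C2 [C20 logb]] := polylog_bound e heps.
(* One [4 ^ k] counts the pairs of zero sets, the other comes from Cauchy-Schwarz, and [2 ^ (2 * k)]
   replaces [H + 1] by [2 * H]. *)
pose C0 := (4 ^ k * (4 ^ k * C1) * 2 ^ (2 * k))%N.
exists (C0%:R * C2) => p n s kk F w L H N Hs p_pr _ _ kk0 sk cF pb rkL H0 Hp HH.
have [tau sys] := ext_system p_pr kk0 cF pb.
have wk : wt kk setT = k by rewrite -sk /wt; apply: eq_bigl => i; rewrite inE.
have mp : (H.+1 ^ 2 <= 4 * p)%N.
  by rewrite -mulnn; move: Hp H0; rewrite -mulnn; nia.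
have h1 := leq_trans (Enk_le_pairs w p_pr rkL N H0 Hp HH)
  (box_pairs sys (ext_good p_pr cF pb rkL) wk EB _ (ltn0Sn H) mp).
have h2 : (Enk w L N Hs <= C0 * H ^ (2 * k) * lg p ^ e)%N.
  apply: leq_trans h1 _.
  have hH : (H.+1 ^ (2 * k) <= (2 * H) ^ (2 * k))%N by apply: leq_pow; lia.
  rewrite expnMn in hH; rewrite /C0 !mulnA leq_mul2r; apply/orP; right.
  rewrite -!mulnA; do 3! (apply: leq_mul => //); exact: hH.
apply: (@le_trans _ _ (C0 * H ^ (2 * k) * lg p ^ e)%N%:R); first by rewrite ler_nat.
clearbody C0; rewrite !natrM [(H ^ _)%:R]natrX -!mulrA ler_wpM2l ?ler0n //.
by rewrite [X in _ <= X]mulrCA ler_wpM2l ?exprn_ge0 ?ler0n // logb.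
Qed.
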